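(* Consider the linear SDE in $\mathbb R^d$ $$\mathrm dX^{\mathrm{true}}(t)=A(t)X^{\mathrm{true}}(t)\mathrm dt+\sum_{i=1}^mB_i(t)X^{\mathrm{true}}(t)\mathrm dW^i_t,\qquad t\in[0,+\infty),$$ with deterministic time-dependent matrices $A(t),B_i(t)\in\mathbb R^{d\times d}$, $i=1,\dots,m$. Let $0=t_0<t_1<\dots$ be a time grid with steps $\Delta t_n=t_{n+1}-t_n$, and suppose that for all $n$ $$\Big|1+\lambda_{\max}(A(t_n)+A(t_n)^\top)\Delta t_n+\sigma_{\max}(A(t_n))^2(\Delta t_n)^2+\sum_{i=1}^m|B_i(t_n)|^2\Delta t_n\Big|<1 .$$ Then the DLR Projector Splitting scheme for SDEs applied to this linear SDE is asymptotically mean-square stable.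
   Context: Notation. $W=(W^1,\dots,W^m)$ is an $m$-dimensional $(\mathcal F_t)$-Brownian motion on a filtered complete probability space with the usual conditions; $|v|$ is the Euclidean norm, $|B|$ the spectral norm, $\sigma_{\max}$ the largest singular value, $\lambda_{\max}$ the largest eigenvalue of a symmetric matrix; $1\le k\le d$. As a standing assumption $x\mapsto A(t)x$, $x\mapsto B_i(t)x$ are Lipschitz uniformly in $t$. For $Y\in L^2(\Omega;\mathbb R^k)$, $C_Y:=\mathbb E[YY^\top]$; for $U\in\mathbb R^{k\times d}$ with orthonormal rows, $P_U:=U^\top U$; $\Delta W^i_n=W^i(t_{n+1})-W^i(t_n)$. DLR Projector Splitting scheme for SDEs, applied to this SDE. Given $U_0$ with $U_0U_0^\top=I_{k\times k}$ and $\mathcal F_0$-measurable $Y_0\in L^2(\Omega;\mathbb R^k)$, put $X_n=U_n^\top Y_n$ and for $n\ge0$ set $$\tilde Y_{n+1}=Y_n+U_nA(t_n)X_n\Delta t_n+U_n\sum_{i=1}^mB_i(t_n)X_n\Delta W^i_n,$$ let $\tilde U_{n+1}$ solve $$C_{\tilde Y_{n+1}}\tilde U_{n+1}=C_{\tilde Y_{n+1}}U_n+\mathbb E[\tilde Y_{n+1}(A(t_n)X_n)^\top](I_{d\times d}-P_{U_n})\Delta t_n$$ (minimal norm solution if $C_{\tilde Y_{n+1}}$ is singular), compute a reduced QR decomposition $\tilde U_{n+1}^\top=U_{n+1}^\top R_{n+1}$ with $U_{n+1}U_{n+1}^\top=I_{k\times k}$, and set $Y_{n+1}=R_{n+1}\tilde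 Y_{n+1}$. Stability. Asymptotic mean-square stability of the scheme is the discrete analogue of asymptotic $2$-stability of the zero solution: $\sup_{n\ge 0}\mathbb E[|X_n|^2]\to0$ as $\mathbb E[|X_0|^2]\to0$, and $\lim_{n\to\infty}\mathbb E[|X_n|^2]=0$ for all (sufficiently small) initial data.
   Formalization: Mean-square stability is proved as stated; E|X_n|² → 0 is proved only if also the product over j<n of the bounded factors tends to 0, since factors below 1 alone do not suffice (d=k=1, t_n=n, B=0, A(t)=-(t+2)^{-2} gives |X_n| → |X_0|/2). *)

(* Defs.v *)
From HB Require Import structures.
From mathcomp Require Import all_boot all_order all_algebra.
From mathcomp Require Import all_classical all_reals all_analysis.

Set Implicit Arguments.
Unset Strict Implicit.
Unset Printing Implicit Defensive.

Import Order.TTheory GRing.Theory Num.Theory.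
Import numFieldNormedType.Exports.
Local Open Scope classical_set_scope.
Local Open Scope ring_scope.

(* The norm that the library puts on matrices is the max norm, hence the
   explicit Euclidean norm. *)
Definition enorm (R : realType) (d : nat) (v : 'cV[R]_d) : R :=
  Num.sqrt (\sum_i v i 0 ^+ 2).

Definition frobenius (R : realType) (p q : nat) (M : 'M[R]_(p, q)) : R :=
  Num.sqrt (\sum_i \sum_j M i j ^+ 2).

Definition spectral_norm (R : realType) (d : nat) (M : 'M[R]_d) : R :=
  sup [set enorm (M *m x) | x in [set x : 'cV[R]_d | enorm x <= 1]].

(* For a symmetric S of positive size the spectrum is finite and nonempty, so
   that the supremum is the largest eigenvalue. *)
Definition lambda_max (R : realType) (d : nat) (S : 'M[R]_d) : R :=
  sup [set a | eigenvalue S a].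

Definition sigma_max (R : realType) (d : nat) (M : 'M[R]_d) : R :=
  Num.sqrt (lambda_max (M^T *m M)).

Definition lipschitz_coeff (R : realType) (d : nat) (M : R -> 'M[R]_d) : Prop :=
  exists L : R, forall t : R, 0 <= t -> forall x y : 'cV[R]_d,
    enorm (M t *m x - M t *m y) <= L * enorm (x - y).

(* Time runs over [0, +oo[: filtrations, coefficients and Brownian motions are
   functions of a real t of which only the values at t >= 0 are constrained. *)
Record usual_conditions (R : realType) (disp : measure_display)
    (Omega : measurableType disp) (P : probability Omega R)
    (F : R -> set (set Omega)) : Prop := UsualConditions {
  uc_complete : measure_is_complete P ;
  uc_sigma_algebra : forall t : R, 0 <= t -> sigma_algebra setT (F t) ;
  uc_measurable : forall t : R, 0 <= t -> F t `<=` measurable ;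
  uc_mono : forall s t : R, 0 <= s -> s <= t -> F s `<=` F t ;
  uc_null_sets : P.-negligible `<=` F 0 ;
  uc_right_continuous : forall t : R, 0 <= t ->
    \bigcap_(s in [set s | t < s]) F s `<=` F t }.

Definition measurable_wrt (R : realType) (Omega : Type) (G : set (set Omega))
    (X : Omega -> R) : Prop :=
  forall D : set R, measurable D -> G (X @^-1` D).

(* The last two fields say that W t - W s is N(0, (t - s) I_m)-distributed and
   independent of F s; the second parameter of normal_prob is the standard
   deviation. *)
Record brownian_motion (R : realType) (disp : measure_display)
    (Omega : measurableType disp) (P : probability Omega R)
    (F : R -> set (set Omega)) (m : nat) (W : 'I_m -> R -> Omega -> R) : Prop :=
  BrownianMotion {
  bm_adapted : forall i (t : R), 0 <= t -> measurable_wrt (F t) (W i t) ;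
  bm_start : forall i, {ae P, forall w, W i 0 w = 0} ;
  bm_continuous : forall i,
    {ae P, forall w, {within `[0, +oo[, continuous (fun t => W i t w)}} ;
  bm_gaussian : forall i (s t : R), 0 <= s -> s < t ->
    forall D : set R, measurable D ->
      P ((fun w => W i t w - W i s w) @^-1` D)
      = normal_prob 0 (Num.sqrt (t - s)) D ;
  bm_independent : forall s t : R, 0 <= s -> s < t ->
    forall E, F s E -> forall D : 'I_m -> set R, (forall i, measurable (D i)) ->
      P (E `&` \bigcap_(i in [set: 'I_m])
                 ((fun w => W i t w - W i s w) @^-1` D i))
      = (P E *
         \prod_(i < m) P ((fun w => W i t w - W i s w)%R @^-1` D i))%E }.

Definition expectation_mx (R : realType) (disp : measure_display)
    (Omega : measurableType disp) (P : probability Omega R) (p q : nat)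
    (M : Omega -> 'M[R]_(p, q)) : 'M[R]_(p, q) :=
  \matrix_(i, j) fine ('E_P[fun w => M w i j])%E.

Definition second_moment_mx (R : realType) (disp : measure_display)
    (Omega : measurableType disp) (P : probability Omega R) (k : nat)
    (Y : Omega -> 'cV[R]_k) : 'M[R]_k :=
  expectation_mx P (fun w => Y w *m (Y w)^T).

Definition mean_square (R : realType) (disp : measure_display)
    (Omega : measurableType disp) (P : probability Omega R) (d : nat)
    (X : Omega -> 'cV[R]_d) : \bar R :=
  ('E_P[fun w => (enorm (X w) ^+ 2)%R])%E.

Definition row_projector (R : realType) (k d : nat) (U : 'M[R]_(k, d)) :
    'M[R]_d := U^T *m U.

Definition min_norm_solution (R : realType) (k d : nat) (C : 'M[R]_k)
    (D M : 'M[R]_(k, d)) : Prop :=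
  C *m M = D /\
  forall N : 'M[R]_(k, d), C *m N = D -> frobenius M <= frobenius N.

(* M^T = U^T Q with orthonormal rows of U and Q upper triangular; is_trig_mx
   means lower triangular. The factors need not be unique. *)
Definition reduced_qr (R : realType) (k d : nat) (M U : 'M[R]_(k, d))
    (Q : 'M[R]_k) : Prop :=
  [/\ M^T = U^T *m Q, U *m U^T = 1%:M & is_trig_mx Q^T].

Definition dlr_approx (R : realType) (Omega : Type) (k d : nat)
    (U : nat -> 'M[R]_(k, d)) (Y : nat -> Omega -> 'cV[R]_k)
    (n : nat) (w : Omega) : 'cV[R]_d := (U n)^T *m Y n w.

(* The step (U, Y) -> (U', Y') is a relation because a QR decomposition is not
   unique. If the second moment matrix of Yt is invertible, the minimal norm
   solution Ut is the only solution. *)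
Definition dlr_step (R : realType) (disp : measure_display)
    (Omega : measurableType disp) (P : probability Omega R) (m d k : nat)
    (A : 'M[R]_d) (B : 'I_m -> 'M[R]_d) (dt : R) (dW : 'I_m -> Omega -> R)
    (U : 'M[R]_(k, d)) (Y : Omega -> 'cV[R]_k)
    (U' : 'M[R]_(k, d)) (Y' : Omega -> 'cV[R]_k) : Prop :=
  let X w := U^T *m Y w in
  let Yt w := Y w + dt *: (U *m (A *m X w))
                  + U *m (\sum_(i < m) dW i w *: (B i *m X w)) in
  let C := second_moment_mx P Yt in
  exists (Ut : 'M[R]_(k, d)) (Q : 'M[R]_k),
    [/\ min_norm_solution C
          (C *m U + dt *: (expectation_mx P (fun w => Yt w *m (A *m X w)^T)
                           *m (1%:M - row_projector U))) Ut,
        reduced_qr Ut U' Q &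
        forall w, Y' w = Q *m Yt w].

Definition dlr_scheme (R : realType) (disp : measure_display)
    (Omega : measurableType disp) (P : probability Omega R)
    (F : R -> set (set Omega)) (m d k : nat) (W : 'I_m -> R -> Omega -> R)
    (A : R -> 'M[R]_d) (B : 'I_m -> R -> 'M[R]_d) (t : nat -> R)
    (U : nat -> 'M[R]_(k, d)) (Y : nat -> Omega -> 'cV[R]_k) : Prop :=
  [/\ U 0%N *m (U 0%N)^T = 1%:M,
      forall j : 'I_k, measurable_wrt (F 0) (fun w => Y 0%N w j 0),
      forall j : 'I_k, (fun w => Y 0%N w j 0) \in Lfun P 2%:E &
      forall n, dlr_step P (A (t n)) (fun i => B i (t n)) (t n.+1 - t n)
                  (fun i w => W i (t n.+1) w - W i (t n) w)
                  (U n) (Y n) (U n.+1) (Y n.+1)].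

(* Stability of a scheme S, given as the set of its runs (U, Y), with respect
   to the initial data. *)
Definition mean_square_stable (R : realType) (disp : measure_display)
    (Omega : measurableType disp) (P : probability Omega R) (k d : nat)
    (S : (nat -> 'M[R]_(k, d)) -> (nat -> Omega -> 'cV[R]_k) -> Prop) : Prop :=
  forall eps : R, 0 < eps -> exists2 delta : R, 0 < delta &
    forall U Y, S U Y ->
      (mean_square P (dlr_approx U Y 0) < delta%:E)%E ->
      (ereal_sup (range (fun n => mean_square P (dlr_approx U Y n)))
        < eps%:E)%E.

Definition asymptotically_mean_square_stable (R : realType)
    (disp : measure_display) (Omega : measurableType disp)
    (P : probability Omega R) (k d : nat)
    (S : (nat -> 'M[R]_(k, d)) -> (nat -> Omega -> 'cV[R]_k) -> Prop) : Prop :=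
  mean_square_stable P S /\
  forall U Y, S U Y ->
    (fun n => mean_square P (dlr_approx U Y n)) @ \oo --> 0%E.

(* One-step bound for E|X_n|^2 at a time with coefficients A, B i and step dt. *)
Definition growth_factor (R : realType) (m d : nat) (A : 'M[R]_d)
    (B : 'I_m -> 'M[R]_d) (dt : R) : R :=
  1 + lambda_max (A + A^T) * dt + sigma_max A ^+ 2 * dt ^+ 2
    + \sum_(i < m) spectral_norm (B i) ^+ 2 * dt.

(* Main.v *)
Require Import Defs.
From HB Require Import structures.
From mathcomp Require Import all_boot all_order all_algebra.
From mathcomp Require Import all_classical all_reals all_analysis.
From mathcomp Require Import measurable_realfun ring lra.

Set Implicit Arguments.
Unset Strict Implicit.
Unset Printing Implicit Defensive.

Import Order.TTheory GRing.Theory Num.Theory.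
Import numFieldNormedType.Exports.
Local Open Scope classical_set_scope.
Local Open Scope ring_scope.

(** Write X = U^T Y, let P = U^T U be the projector of a step, W_i the increments
    and b = sum_i W_i B_i X. The equation for the new basis Ut is the normal
    equation of a least squares problem: Ut^T Yt is the orthogonal projection, in
    L^2, of V = U^T Yt + dt (1 - P) A X onto the linear span of the components of
    Yt. Hence E|Ut^T Yt|^2 <= E|V|^2, while P X = X gives
    V = X + dt A X + P b. The increments are centered, mutually independent, of
    variance dt and independent of the past, so that
    E|V|^2 <= E|X + dt A X|^2 + E|b|^2 is at most the growth factor times E|X|^2. *)

(** * Moments of the normal distribution *)

(** The normal equation is an identity between matrices, the bound an inequality between scalars;
    [E<X, Y> = tr E[X Y^T]] passes from one to the other. The factor [Q] of the QR decomposition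
    only moves between basis and coefficients, so [U'^T Y' = Ut^T Yt], and the estimate for
    [Ut^T Yt] is already the one for the new approximation. Centering is used in the forms [E[Z W_i]
    = 0] and [E[Z W_i W_j] = 0] for integrable [Z] measurable at the start of the step; the second
    rests on the independence of the product [Z W_i] from [W_j], which has to be extracted from a
    factorisation over measurable rectangles. These facts apply only if [Y n] is measurable for
    [F (t n)], so this is carried through the iteration along with orthonormality and square
    integrability. The variance and the spectral quantities enter as upper bounds only, the latter
    through the Rayleigh quotient. *)

Section density.
Context d (T : measurableType d) (R : realType).
Variables (mu nu : {measure set T -> \bar R}) (g : T -> R).
Hypotheses (g0 : forall x, 0 <= g x) (mg : measurable_fun setT g).
Hypothesis nuE : forall A, measurable A -> nu A = (\int[mu]_(x in A) (g x)%:E)%E.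

Import HBNNSimple.

(** By monotone convergence both sides are limits over simple functions increasing to [f], and on
    the indicator of a level set the identity is [nuE]. *)
Lemma ge0_integral_density (f : T -> \bar R) : measurable_fun setT f ->
  (forall x, (0 <= f x)%E) ->
  (\int[nu]_x f x = \int[mu]_x (f x * (g x)%:E))%E.
Proof.
move=> mf f0.
pose f_ := nnsfun_approx measurableT mf.
transitivity (limn (fun n => (\int[nu]_x (f_ n x)%:E)%E)).
  rewrite -monotone_convergence//.
  - apply: eq_integral => y _; apply/esym/cvg_lim => //.
    exact: cvg_nnsfun_approx.
  - by move=> n; exact/measurable_EFinP/measurable_funP.
  - by move=> n y _; rewrite lee_fin.
  - by move=> y _ m n mn; rewrite lee_fin; exact/lefP/nd_nnsfun_approx.
transitivity (limn (fun n => (\int[mu]_x ((f_ n x)%:E * (g x)%:E))%E)); last first.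
  rewrite -monotone_convergence//.
  - apply: eq_integral => y _; apply/cvg_lim => //.
    apply: cvgeZr => //.
    exact: cvg_nnsfun_approx.
  - move=> n; apply: emeasurable_funM; first exact/measurable_EFinP/measurable_funP.
    exact/measurable_EFinP.
  - by move=> n y _; rewrite mule_ge0// lee_fin.
  - move=> y _ m n mn; rewrite lee_wpmul2r ?lee_fin//.
    exact/lefP/nd_nnsfun_approx.
congr (limn _); apply/funext => n.
have mfn k : measurable (f_ n @^-1` [set k]) by exact: measurable_sfunP.
transitivity (\sum_(k \in range (f_ n))
    \int[nu]_x (k * \1_(f_ n @^-1` [set k]) x)%:E)%E.
  under eq_integral do rewrite fimfunE -fsumEFin//.
  rewrite ge0_integral_fsum//.
  - by move=> y; exact/measurable_EFinP/measurable_funM.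
  - by move=> y x _; rewrite nnfun_muleindic_ge0.
transitivity (\sum_(k \in range (f_ n))
    \int[mu]_x ((k * \1_(f_ n @^-1` [set k]) x)%:E * (g x)%:E))%E; last first.
  rewrite -ge0_integral_fsum//.
  - apply: eq_integral => x _.
    rewrite [in RHS]fimfunE -fsumEFin// ge0_mule_fsuml// => y.
    by rewrite nnfun_muleindic_ge0.
  - move=> y; apply: emeasurable_funM; last exact/measurable_EFinP.
    exact/measurable_EFinP/measurable_funM.
  - move=> y x _; rewrite mule_ge0 ?nnfun_muleindic_ge0//.
    by rewrite lee_fin.
apply: eq_fsbigr => r; rewrite inE => -[y _ <-].
under eq_integral do rewrite EFinM.
rewrite ge0_integralZl//; last 2 first.
  - exact/measurable_EFinP.
  - by rewrite lee_fin.
rewrite integral_indic//= setIT nuE//.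
under [RHS]eq_integral do rewrite EFinM -muleA.
rewrite ge0_integralZl//; last 3 first.
  - by apply: emeasurable_funM; exact/measurable_EFinP.
  - by move=> x _; rewrite mule_ge0 ?lee_fin.
  - by rewrite lee_fin.
congr (_ * _)%E; rewrite [LHS]integral_mkcond; apply: eq_integral => x _.
by rewrite patchE indicE; case: ifPn => _; rewrite ?mul1e ?mul0e.
Qed.

End density.

Section normal_moments.
Context {R : realType}.
Notation mu := (@lebesgue_measure R).
Local Open Scope ring_scope.

Lemma ge0_integral_normal_prob (m s : R) (f : R -> \bar R) :
  measurable_fun setT f -> (forall x, (0 <= f x)%E) ->
  (\int[normal_prob m s]_x f x
   = \int[mu]_x (f x * (normal_pdf m s x)%:E))%E.
Proof.
move=> mf f0.
apply: (@ge0_integral_density _ _ R mu (normal_prob m s)) => //.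
  by move=> x; exact: normal_pdf_ge0.
exact: measurable_normal_pdf.
Qed.

Variable s : R.
Hypothesis s0 : 0 < s.
Local Notation pdf := (normal_pdf 0 s).

Let pdfE x : pdf x = normal_peak s * expR (- x ^+ 2 / (s ^+ 2 *+ 2)).
Proof. by rewrite normal_pdfE ?gt_eqF// /normal_fun subr0. Qed.

Lemma is_derive_normal_pdf (x : R) :
  is_derive x (1 : R) pdf (- (x / s ^+ 2) * pdf x).
Proof.
have -> : pdf = (fun x => normal_peak s * expR (- x ^+ 2 / (s ^+ 2 *+ 2))).
  by apply/funext => y; rewrite pdfE.
apply: is_derive_eq.
rewrite /= !scaler0 !add0r /GRing.scale/=.
move: (expR _) => e; field; rewrite gt_eqF//.
Qed.

Lemma derivable_LRcontinuous (f : R -> R) (a b : R) :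
  (forall x, derivable f x 1) -> derivable_oo_LRcontinuous f a b.
Proof.
move=> df.
have cf : continuous f.
  by move=> x; exact/differentiable_continuous/derivable1_diffP/df.
split=> [x _|/=|/=]; first exact: df.
- exact/cvg_at_right_filter/cf.
- exact/cvg_at_left_filter/cf.
Qed.

Lemma le_integral_sqr_normal_pdf :
  (\int[mu]_x (x ^+ 2 * pdf x)%:E <= (s ^+ 2)%:E)%E.
Proof.
have cpdf : continuous pdf by apply: continuous_normal_pdf; rewrite gt_eqF.
have cf : continuous (fun x : R => x ^+ 2 * pdf x).
  by move=> x; apply: cvgM; [exact: sqr_continuous|exact: cpdf].
have pdfN x : pdf (- x) = pdf x by rewrite !pdfE sqrrN.
have i0y (f : R -> \bar R) : (\int[mu]_(x in [set x | (0 <= x)%R]) f x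
    = \int[mu]_(x in `[0%R, +oo[) f x)%E.
  by congr integral; apply/seteqP; split => x/=; rewrite in_itv/= andbT.
have := @integral_normal_pdf R 0 s.
rewrite ge0_symfun_integralT//; first last.
- by move=> x /=; rewrite pdfN.
- by move=> x; exact: normal_pdf_ge0.
rewrite ge0_symfun_integralT//; first last.
- by move=> x /=; rewrite pdfN sqrrN.
- by move=> x; rewrite mulr_ge0 ?sqr_ge0// normal_pdf_ge0.
rewrite !i0y => i1.
(* By evenness both integrals over the line are twice those over the half-line, and the total mass
   is 1 ([i1]). *)
suff : (\int[mu]_(x in `[0%R, +oo[) (x ^+ 2 * pdf x)%:E <=
        (s ^+ 2)%:E * \int[mu]_(x in `[0%R, +oo[) (pdf x)%:E)%E.
  move=> /(@lee_wpmul2l _ 2%:E)/le_trans; apply; rewrite ?lee_fin//.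
  by rewrite muleCA i1 mule1.
have mf : measurable_fun [set: R] (fun x : R => x ^+ 2 * pdf x).
  exact: continuous_measurable_fun.
have f0 (x : R) : 0 <= x ^+ 2 * pdf x.
  by rewrite mulr_ge0 ?sqr_ge0 ?normal_pdf_ge0.
have /cvg_lim <- // := @ge0_cvgn_integral R mu _ f0 mf.
apply: lime_le.
  by apply/cvg_ex; eexists; exact: (@ge0_cvgn_integral R mu _ f0 mf).
near=> n.
have n0 : 0 < n%:R :> R by rewrite ltr0n; near: n; exists 1%N.
(* [G] is an antiderivative of [x * pdf x], so that [x ^+ 2 * pdf x] can be integrated by parts as
   [x] times [G']. *)
pose G x := - s ^+ 2 * pdf x.
have dG x : is_derive x (1 : R) G (x * pdf x).
  have ? := is_derive_normal_pdf x.
  apply: is_derive_eq; rewrite /GRing.scale/=; field.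
  by rewrite gt_eqF.
have -> : (\int[mu]_(x in `[0%R, n%:R]) (x ^+ 2 * pdf x)%:E =
   \int[mu]_(x in `[0%R, n%:R]) (x * (x * pdf x))%:E)%E.
  by apply: eq_integral => x _; rewrite expr2 mulrA.
rewrite (@integration_by_parts R id G (cst 1) (fun x => x * pdf x))//; first last.
- by move=> x _; rewrite derive1E (@derive_val _ _ _ _ _ _ _ (dG x)).
- by apply: derivable_LRcontinuous => x; exact: ex_derive.
- by apply: continuous_subspaceT => x; apply: cvgM; [exact: cvg_id|exact: cpdf].
- by move=> x _; rewrite derive1_id.
- exact: derivable_LRcontinuous.
- by apply: continuous_subspaceT => x; exact: cvg_cst.
rewrite mul0r subr0 /G.
have Ipdf : mu.-integrable `[0%R, n%:R] (fun x => (pdf x)%:E).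
  by apply: integrableS (integrable_normal_pdf 0 s).
under eq_integral do rewrite /= mul1r EFinM.
(* The boundary term [n * G n] is nonpositive; what remains is [s ^+ 2] times the mass of
   [[0, n]]. *)
rewrite integralZl//= EFinN mulNe oppeK -[leRHS]add0e; apply: leeD.
  rewrite lee_fin mulNr mulrN oppr_le0; apply: mulr_ge0 => //.
  by apply: mulr_ge0; rewrite ?sqr_ge0 ?normal_pdf_ge0.
apply: lee_wpmul2l; first by rewrite lee_fin sqr_ge0.
apply: ge0_subset_integral => //.
- by apply/measurable_EFinP/measurable_funTS; exact: measurable_normal_pdf.
- by move=> x _; rewrite lee_fin normal_pdf_ge0.
- by apply: subset_itvl.
Unshelve. all: by end_near. Qed.

End normal_moments.

Lemma ge0_integralN (R : realType) (f : R -> \bar R) :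
  measurable_fun [set: R] f -> (forall x, (0 <= f x)%E) ->
  (\int[@lebesgue_measure R]_x f (- x)%R = \int[@lebesgue_measure R]_x f x)%E.
Proof.
move=> mf f0.
rewrite (_ : \int[lebesgue_measure]_x f x =
  \int[pushforward lebesgue_measure (-%R : _ -> measurableTypeR R)]_x f x)%E.
  by rewrite ge0_integral_pushforward.
by apply: eq_measure_integral => //= A mA _; exact/esym/lebesgue_measureN.
Qed.

Lemma sqr_integrable_Lfun2 d (T : measurableType d) (R : realType)
    (mu : {measure set T -> \bar R}) (f : T -> R) :
  measurable_fun [set: T] f -> (\int[mu]_x (f x ^+ 2)%:E < +oo)%E ->
  f \in Lfun mu 2%:E.
Proof.
move=> mf f2; rewrite inE; apply/andP; split; rewrite inE//=.
rewrite /finite_norm unlock /Lnorm; apply: poweR_lty.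
rewrite (eq_integral (fun x => (f x ^+ 2)%:E))// => x _ /=.
by rewrite powR_mulrn// -normrX ger0_norm ?sqr_ge0.
Qed.

Section normal_random_variable.
Context d (T : measurableType d) (R : realType) (P : probability T R).
Variables (V : T -> R) (s : R).
Hypotheses (s0 : 0 < s) (mV : measurable_fun [set: T] V).
Hypothesis VN : forall D : set R, measurable D ->
  P (V @^-1` D) = normal_prob 0 s D.

Let ge0_integral_comp (f : R -> \bar R) :
  measurable_fun [set: R] f -> (forall x, (0 <= f x)%E) ->
  (\int[P]_w f (V w) = \int[lebesgue_measure]_x (f x * (normal_pdf 0 s x)%:E))%E.
Proof.
move=> mf f0; rewrite -ge0_integral_normal_prob//.
transitivity (\int[pushforward P (V : T -> measurableTypeR R)]_x f x)%E.
  by rewrite ge0_integral_pushforward.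
by apply: eq_measure_integral => A mA _; rewrite /= /pushforward VN.
Qed.

Lemma normal_sqr_le : (\int[P]_w (V w ^+ 2)%:E <= (s ^+ 2)%:E)%E.
Proof.
rewrite (@ge0_integral_comp (fun x => (x ^+ 2)%:E))//.
- under eq_integral do rewrite -EFinM.
  exact: le_integral_sqr_normal_pdf.
- by apply/measurable_EFinP; exact: measurable_funX.
- by move=> x; rewrite lee_fin sqr_ge0.
Qed.

Lemma normal_Lfun2 : V \in Lfun P 2%:E.
Proof.
apply: sqr_integrable_Lfun2 => //.
exact: le_lt_trans normal_sqr_le (ltry _).
Qed.

(** The density is even, so the positive and negative parts of [V] have equal integrals; they may be
    subtracted because [V], being square integrable under a probability, is integrable. *)
Lemma normal_mean0 : (\int[P]_w (V w)%:E)%E = 0%E.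
Proof.
have iV : P.-integrable [set: T] (EFin \o V).
  apply/Lfun1_integrable/Lfun_subset12; last exact: normal_Lfun2.
  exact: fin_num_measure.
have mm : measurable_fun [set: R] (fun x : R => (Num.max x 0)%:E).
  by apply/measurable_EFinP/measurable_maxr.
have m0 (x : R) : (0 <= (Num.max x 0)%:E)%E by rewrite lee_fin le_max lexx orbT.
have pdfN (x : R) : normal_pdf 0 s (- x) = normal_pdf 0 s x.
  by rewrite normal_pdfE ?gt_eqF// /normal_fun !subr0 sqrrN.
rewrite integralE.
have -> : (\int[P]_w ((fun w => (V w)%:E)^\- w) =
           \int[P]_w ((fun w => (V w)%:E)^\+ w))%E.
  transitivity (\int[P]_w (Num.max (- V w) 0)%:E)%E.
    by apply: eq_integral => w _; rewrite funenegE -EFinN EFin_max.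
  transitivity (\int[P]_w (Num.max (V w) 0)%:E)%E; last first.
    by apply: eq_integral => w _; rewrite funeposE EFin_max.
  rewrite (@ge0_integral_comp (fun x => (Num.max (- x) 0)%:E))//; last first.
    exact: measurableT_comp mm _.
  rewrite (@ge0_integral_comp (fun x => (Num.max x 0)%:E))//.
  rewrite -ge0_integralN/=.
  - by apply: eq_integral => x _; rewrite opprK pdfN.
  - apply: emeasurable_funM; first exact: measurableT_comp mm _.
    apply/measurable_EFinP.
    exact: measurable_normal_pdf.
  - by move=> x; rewrite mule_ge0// lee_fin normal_pdf_ge0.
rewrite subee//; apply: integrable_fin_num => //.
exact: integrable_funepos.
Qed.

End normal_random_variable.

(** * Independence and products *)

Definition independent_rv d (T : measurableType d) (R : realType)
    (P : probability T R) (Z V : T -> R) : Prop :=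
  forall A B : set R, measurable A -> measurable B ->
    P (Z @^-1` A `&` V @^-1` B) = (P (Z @^-1` A) * P (V @^-1` B))%E.

Section independence.
Context d (T : measurableType d) (R : realType) (P : probability T R).
Local Open Scope ereal_scope.

Section joint_law.
Variables Z V : {mfun T >-> R}.
Hypothesis ZV : independent_rv P Z V.

Let joint_measurable : measurable_fun [set: T] (fun w => (Z w, V w)).
Proof. exact: measurable_fun_pair. Qed.

Let joint : {mfun T >-> (R * R)%type} := mfun_Sub (mem_set joint_measurable).

(** Independence is the equality of the two laws on rectangles, and rectangles determine a product
    measure. *)
Let joint_law (X : set (R * R)) : measurable X ->
  (distribution P Z \x distribution P V) X = distribution P joint X.
Proof.
apply: product_measure_unique => A B mA mB.
by rewrite -ZV.
Qed.

Let integral_joint (f : R * R -> \bar R) : measurable_fun setT f ->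
  (forall x, 0 <= f x) ->
  \int[P]_w f (Z w, V w) =
  \int[distribution P Z \x distribution P V]_z f z.
Proof.
move=> mf f0.
rewrite (_ : \int[P]_w f (Z w, V w) = \int[distribution P joint]_z f z); last first.
  by rewrite ge0_integral_distribution.
by apply: eq_measure_integral => X mX _; exact/esym/joint_law.
Qed.

Lemma ge0_integral_indep (f g : R -> \bar R) :
  measurable_fun setT f -> measurable_fun setT g ->
  (forall x, 0 <= f x) -> (forall x, 0 <= g x) ->
  \int[P]_w (f (Z w) * g (V w)) = \int[P]_w f (Z w) * \int[P]_w g (V w).
Proof.
move=> mf mg f0 g0.
have mfg : measurable_fun setT (fun z : R * R => f z.1 * g z.2).
  by apply: emeasurable_funM; exact: measurableT_comp.
rewrite (integral_joint mfg); last by move=> x; rewrite mule_ge0.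
rewrite fubini_tonelli1//; last by move=> x; rewrite mule_ge0.
rewrite /fubini_F/=.
under eq_integral do rewrite ge0_integralZl//.
rewrite ge0_integralZr// ?integral_ge0//.
by rewrite !ge0_integral_distribution.
Qed.

(** The nonnegative case applied to [|Z|] and [|V|] shows that the product is integrable, which is
    what justifies Fubini on the product law. *)
Lemma integral_indep :
  P.-integrable setT (EFin \o Z) -> P.-integrable setT (EFin \o V) ->
  P.-integrable setT (fun w => (Z w * V w)%:E) /\
  \int[P]_w (Z w * V w)%:E = \int[P]_w (Z w)%:E * \int[P]_w (V w)%:E.
Proof.
move=> iZ iV.
have mh : measurable_fun setT (fun z : R * R => (z.1 * z.2)%:E).
  by apply/measurable_EFinP; apply: measurable_funM.
have ma : measurable_fun setT (fun x : R => `|x|%:E).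
  by apply/measurable_EFinP; exact: (measurableT_comp (@normr_measurable _ _)).
have iZV : P.-integrable setT (fun w => (Z w * V w)%:E).
  apply/integrableP; split.
    by apply/measurable_EFinP; exact: measurable_funM.
  under eq_integral do rewrite abse_EFin normrM EFinM.
  rewrite (@ge0_integral_indep (fun x => `|x|%:E) (fun x => `|x|%:E))//.
  move/integrableP : iZ => [_ iZ]; move/integrableP : iV => [_ iV].
  by rewrite lte_mul_pinfty// ?ge0_fin_numE// integral_ge0.
split => //.
transitivity (\int[distribution P joint]_z (z.1 * z.2)%:E).
  by rewrite integral_distribution.
transitivity (\int[distribution P Z \x distribution P V]_z (z.1 * z.2)%:E).
  by apply: eq_measure_integral => X mX _; exact/esym/joint_law.
rewrite -integral12_prod_meas1.
- rewrite /fubini_F/=.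
  have mE : measurable_fun [set: R] (EFin : R -> \bar R).
    exact/measurable_EFinP.
  have iZ' : (distribution P Z).-integrable setT (fun x => x%:E).
    exact: integrable_pushforward.
  have iV' : (distribution P V).-integrable setT (fun y => y%:E).
    exact: integrable_pushforward.
  transitivity (\int[distribution P Z]_x (x%:E * \int[P]_w (V w)%:E)).
    apply: eq_integral => x _; under eq_integral do rewrite EFinM.
    by rewrite integralZl// integral_distribution.
  rewrite -(fineK (integrable_fin_num measurableT iV)).
  by rewrite integralZr// integral_distribution.
- apply/integrableP; split => //.
  have /integrableP[_] := iZV.
  by rewrite (@integral_joint (fun z => `|(z.1 * z.2)%:E|))//; exact: measurableT_comp.
Qed.

End joint_law.

(** With [C] fixed, the law of [(Z, V)] restricted to the event that [V'] lies in [C] is compared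
    with the law of [(Z, V)] scaled by the probability of that event. Both agree with one product
    measure on rectangles, hence with each other on the set [X] where the product of the coordinates
    lies in [A]. *)
Lemma independent_rvM (Z V V' : {mfun T >-> R}) :
  (forall A B C : set R, measurable A -> measurable B -> measurable C ->
    P (Z @^-1` A `&` V @^-1` B `&` V' @^-1` C) =
    P (Z @^-1` A) * P (V @^-1` B) * P (V' @^-1` C)) ->
  independent_rv P (fun w => Z w * V w)%R V'.
Proof.
move=> ind A C mA mC.
have mV'C : measurable (V' @^-1` C).
  exact: measurable_funPTI.
have mZV : measurable_fun [set: T] (fun w => (Z w, V w)).
  exact: measurable_fun_pair.
pose joint : {mfun T >-> (R * R)%type} := mfun_Sub (mem_set mZV).
have r0 : (0 <= fine (P (V' @^-1` C)))%R by rewrite fine_ge0.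
pose r := NngNum r0.
have rE : r%:num%:E = P (V' @^-1` C) by rewrite fineK// fin_num_measure.
pose mu1 : {measure set (R * R) -> \bar R} := pushforward (mrestr P mV'C) joint.
pose mu2 : {measure set (R * R) -> \bar R} := mscale r (distribution P joint).
pose X := (fun z : R * R => z.1 * z.2)%R @^-1` A.
have mX : measurable X.
  rewrite -[X in measurable X]setTI.
  by apply: (measurable_funM measurable_fst measurable_snd).
have : mu1 mZV X = mu2 X.
  transitivity ((mscale r (distribution P Z) \x distribution P V) X).
    apply/esym/product_measure_unique => // A' B' mA' mB'.
    rewrite /mu1 /= /pushforward /mrestr/= /mscale/= rE /distribution.
    by rewrite -[X in P X]/(Z @^-1` A' `&` V @^-1` B' `&` V' @^-1` C) ind// muleC muleA.
  apply/product_measure_unique => // A' B' mA' mB'.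
  rewrite /mu2 /= /mscale/= rE /distribution -muleA; congr (_ * _).
  (* The choice [C = setT] turns the triple factorisation into the independence of [Z] and [V]. *)
  have := ind A' B' setT mA' mB' measurableT.
  by rewrite preimage_setT setIT probability_setT mule1.
by rewrite /mu1 /mu2 /= /pushforward /mrestr/= /mscale/= rE muleC.
Qed.

End independence.

(** * Euclidean inner product and matrix norms *)

Section dot.
Context {R : realType} {d : nat}.
Implicit Types (u v w : 'cV[R]_d) (a : R).

Definition dot u v : R := (u^T *m v) 0 0.

Lemma dotE u v : dot u v = \sum_i u i 0 * v i 0.
Proof. by rewrite /dot mxE; apply: eq_bigr => i _; rewrite mxE. Qed.

Lemma dotC u v : dot u v = dot v u.
Proof. by rewrite !dotE; apply: eq_bigr => i _; rewrite mulrC. Qed.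

Lemma dotDr u v w : dot u (v + w) = dot u v + dot u w.
Proof. by rewrite /dot mulmxDr mxE. Qed.

Lemma dotDl u v w : dot (u + v) w = dot u w + dot v w.
Proof. by rewrite !(dotC _ w) dotDr. Qed.

Lemma dotZr a u v : dot u (a *: v) = a * dot u v.
Proof. by rewrite /dot -scalemxAr mxE. Qed.

Lemma dotZl a u v : dot (a *: u) v = a * dot u v.
Proof. by rewrite !(dotC _ v) dotZr. Qed.

Lemma dotNr u v : dot u (- v) = - dot u v.
Proof. by rewrite -scaleN1r dotZr mulN1r. Qed.

Lemma dotNl u v : dot (- u) v = - dot u v.
Proof. by rewrite !(dotC _ v) dotNr. Qed.

Lemma dot_ge0 v : 0 <= dot v v.
Proof. by rewrite dotE sumr_ge0// => i _; rewrite -expr2 sqr_ge0. Qed.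

Lemma dot_eq0 v : (dot v v == 0) = (v == 0).
Proof.
apply/eqP/eqP => [|->]; last by rewrite /dot mulmx0 mxE.
rewrite dotE => /eqP; rewrite psumr_eq0 => [/allP v0|i _]; last first.
  by rewrite -expr2 sqr_ge0.
apply/matrixP => i j; rewrite ord1 mxE; apply/eqP.
have := v0 i (mem_index_enum i).
by rewrite /= mulf_eq0 orbb.
Qed.

Lemma dot_gt0 v : v != 0 -> 0 < dot v v.
Proof. by move=> v0; rewrite lt_neqAle eq_sym dot_eq0 v0 dot_ge0. Qed.

Lemma enorm_sqr v : enorm v ^+ 2 = dot v v.
Proof.
rewrite /enorm sqr_sqrtr; last by rewrite sumr_ge0// => i _; exact: sqr_ge0.
by rewrite dotE; apply: eq_bigr => i _; rewrite expr2.
Qed.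

Lemma enorm_ge0 v : 0 <= enorm v. Proof. exact: sqrtr_ge0. Qed.

Lemma enormZ a v : enorm (a *: v) = `|a| * enorm v.
Proof.
apply/eqP; rewrite -(@eqrXn2 _ 2)// ?mulr_ge0 ?enorm_ge0//.
by rewrite exprMn !enorm_sqr dotZl dotZr mulrA real_normK ?num_real// expr2.
Qed.

End dot.

Lemma dot_mulmxl (R : realType) (p q : nat) (M : 'M[R]_(p, q)) u v :
  dot (M *m u) v = dot u (M^T *m v).
Proof. by rewrite /dot trmx_mul mulmxA. Qed.

(** * The Rayleigh quotient of a symmetric matrix *)

Section rayleigh.
Context {R : realType} {d : nat}.
Variable S : 'M[R]_d.
Hypothesis symS : S^T = S.

Let q (v : 'cV[R]_d) := dot v (S *m v).

Let continuous_form (M : 'M[R]_d) :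
  continuous (fun v : 'rV[R]_d => dot v^T (M *m v^T)).
Proof.
have -> : (fun v : 'rV[R]_d => dot v^T (M *m v^T)) =
    (fun v => \sum_i v 0 i * \sum_j (M i j * v 0 j)).
  apply/funext => v; rewrite dotE; apply: eq_bigr => i _.
  by rewrite !mxE; congr (_ * _); apply: eq_bigr => j _; rewrite mxE.
have cc i : continuous (fun v : 'rV[R]_d => v 0 i) by exact: coord_continuous.
apply: continuous_big => [|i _]; first exact: add_continuous.
suff c : continuous (fun v : 'rV[R]_d => \sum_j M i j * v 0 j).
  by move=> v; exact: (continuousM (cc i v) (c v)).
apply: continuous_big => [|j _ v]; first exact: add_continuous.
exact: (continuousM (@cst_continuous _ _ (M i j) v) (cc j v)).
Qed.

(** The form is continuous on the compact unit sphere, and homogeneity carries the bound to all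
    vectors. The sphere is taken among row vectors, to which [EVT_max_rV] applies. *)
Lemma rayleigh_max : (0 < d)%N -> exists2 v : 'cV[R]_d, dot v v = 1 &
  forall w, q w <= q v * dot w w.
Proof.
move=> d0.
pose A : set 'rV[R]_d := [set v | dot v^T v^T = 1].
have A0 : A !=set0.
  exists (delta_mx 0 (Ordinal d0)); rewrite /A /= trmx_delta /dot.
  by rewrite trmx_delta mul_delta_mx mxE !eqxx.
have bA : bounded_set A.
  exists 1; split; first exact: num_real.
  move=> M M1 v Av; rewrite /= (le_trans _ (ltW M1))//.
  rewrite /Num.norm/= mx_normrE; apply: bigmax_le => // -[i j] _ /=.
  rewrite ord1 -(@ler_pXn2r _ 2)// ?nnegrE// expr1n real_normK ?num_real//.
  rewrite -Av dotE (bigD1 j)//= !mxE -expr2 lerDl sumr_ge0// => k _.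
  by rewrite -expr2 sqr_ge0.
have clA : closed A.
  rewrite (_ : A = (fun v : 'rV[R]_d => dot v^T (1%:M *m v^T)) @^-1` [set 1]).
    apply: closed_comp; last exact: closed_eq.
    by move=> v _; exact: continuous_form.
  by apply/seteqP; split => v; rewrite /A /= mul1mx.
have [] := EVT_max_rV A0 (bounded_closed_compact bA clA)
    (continuous_subspaceT (@continuous_form S)).
move=> c; rewrite inE => Ac maxc; exists c^T => // w.
have [->|w0] := eqVneq w 0; first by rewrite /q mulmx0 /dot mulmx0 mxE mulr0.
have ww := dot_gt0 w0.
pose a := (enorm w)^-1.
have a2 : a ^+ 2 * dot w w = 1.
  by rewrite exprVn enorm_sqr mulVf// gt_eqF.
have := maxc (a *: w)^T; rewrite inE /A /= trmxK dotZl dotZr mulrA -expr2 => /(_ a2).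
rewrite -scalemxAr dotZl dotZr mulrA -expr2 => maxw.
have -> : q w = dot w w * (a ^+ 2 * q w).
  by rewrite mulrA [_ * a ^+ 2]mulrC a2 mul1r.
by rewrite mulrC ler_pM2r// (le_trans maxw).
Qed.

(** A first-order variation: if [S v] had a component [z] orthogonal to [v], moving from [v] along
    [z] would raise the quotient, against maximality. *)
Lemma rayleigh_eigen (v : 'cV[R]_d) : dot v v = 1 ->
  (forall w, q w <= q v * dot w w) -> S *m v = q v *: v.
Proof.
move=> v1 maxv.
have [z zE] : exists z, S *m v = q v *: v + z.
  by exists (S *m v - q v *: v); rewrite addrC subrK.
have qvz : dot v z = 0.
  have : dot v (S *m v) = q v by [].
  rewrite zE dotDr dotZr v1 mulr1 => /eqP.
  by rewrite -subr_eq0 addrAC subrr add0r => /eqP.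
(* Maximality tested at [v + t z]: the first-order gain is on the left, the second-order terms are
   on the right. *)
have key t : 2 * t * dot z z <= t ^+ 2 * (q v * dot z z - q z).
  have := maxv (v + t *: z); rewrite {1}/q mulmxDr -scalemxAr.
  rewrite !(dotDl, dotDr, dotZl, dotZr) (dotC z v) qvz v1.
  have -> : dot v (S *m z) = dot (S *m v) z by rewrite dot_mulmxl symS.
  have -> : dot z (S *m v) = dot (S *m v) z by rewrite dotC.
  rewrite -/(q v) -/(q z) {1 2}zE !dotDl !dotZl qvz.
  by move: (q v) (q z) (dot z z) => a b c; lra.
suff : dot z z = 0 by move/eqP; rewrite dot_eq0 zE => /eqP ->; rewrite addr0.
apply/eqP; rewrite eq_le dot_ge0 andbT leNgt; apply/negP => zz0.
set K := q v * dot z z - q z in key.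
have K1 : 0 < `|K| + 1 by rewrite ltr_wpDl.
(* This [t] is small enough for [t * K < dot z z], which contradicts [key t]; the added 1 keeps the
   divisor positive when [K = 0]. *)
have [t t0 tK] : exists2 t, 0 < t & t * (`|K| + 1) = dot z z.
  by exists (dot z z / (`|K| + 1)); rewrite ?divr_gt0// divfK// gt_eqF.
have tK' : t * K < dot z z.
  rewrite -tK ltr_pM2l// (le_lt_trans (ler_norm K))// ltrDl.
  exact: ltr01.
have := key t; apply/negP; rewrite -ltNge expr2 -!mulrA [2 * _]mulrCA ltr_pM2l//.
by apply: (lt_trans tK'); rewrite ltr_pMl// ltr1n.
Qed.

(** The maximum of the form on the unit sphere is an eigenvalue and bounds every other one, so the
    spectrum is bounded above and its [sup] dominates that maximum. Treating [w = 0] apart also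
    covers [d = 0], where there is no unit vector. *)
Lemma rayleigh_le (w : 'cV[R]_d) : dot w (S *m w) <= lambda_max S * dot w w.
Proof.
have [->|w0] := eqVneq w 0; first by rewrite mulmx0 /dot mulmx0 mxE mulr0.
have d0 : (0 < d)%N.
  rewrite lt0n; apply: contra_neq w0 => d0; apply/matrixP => i.
  by have := ltn_ord i; rewrite {2}d0.
have [v v1 maxv] := rayleigh_max d0.
have Sv := rayleigh_eigen v1 maxv.
apply: (le_trans (maxv w)); apply: ler_wpM2r; first exact: dot_ge0.
apply: ub_le_sup.
(* [eigenvalue] speaks of row eigenvectors; the symmetry of [S] transposes them. *)
- exists (q v) => a /= /eigenvalueP[u uS u0].
  have u0' : 0 < dot u^T u^T by rewrite dot_gt0// trmx_eq0.
  rewrite -(ler_pM2r u0'); apply: le_trans (maxv u^T).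
  by rewrite /q -dotZr -symS -trmx_mul uS linearZ.
- apply/eigenvalueP; exists v^T; last first.
    rewrite trmx_eq0; apply: contra_eq_neq v1 => ->.
    by rewrite /dot mulmx0 mxE eq_sym oner_eq0.
  by rewrite -{1}symS -trmx_mul Sv linearZ.
Qed.

End rayleigh.

(** * Bounds by the spectral quantities of the growth factor *)

Section norms.
Context {R : realType} {d : nat}.
Implicit Types (M : 'M[R]_d) (v : 'cV[R]_d).

Lemma dot_mulmx_le_sigma_max M v :
  dot (M *m v) (M *m v) <= sigma_max M ^+ 2 * dot v v.
Proof.
rewrite dot_mulmxl mulmxA.
apply: (@le_trans _ _ (lambda_max (M^T *m M) * dot v v)).
  by apply: rayleigh_le; rewrite trmx_mul trmxK.
apply: ler_wpM2r; first exact: dot_ge0.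
(* [Num.sqrt] is 0 on negative numbers; a negative [lambda_max] is below any square, so the bound
   holds for either sign. *)
rewrite /sigma_max; have [l0|/ltW l0] := leP 0 (lambda_max (M^T *m M)).
  by rewrite sqr_sqrtr.
by rewrite (le_trans l0)// sqr_ge0.
Qed.

Lemma dot_mulmx_le_spectral_norm M v :
  dot (M *m v) (M *m v) <= spectral_norm M ^+ 2 * dot v v.
Proof.
have [->|v0] := eqVneq v 0; first by rewrite mulmx0 /dot mulmx0 mxE mulr0.
have v1 := dot_gt0 v0.
have e0 : 0 < enorm v.
  by rewrite lt_neqAle enorm_ge0 andbT eq_sym -sqrf_eq0 enorm_sqr gt_eqF.
have s0 : 0 <= sigma_max M by exact: sqrtr_ge0.
have key : enorm (M *m ((enorm v)^-1 *: v)) <= spectral_norm M.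
  (* A [sup] dominates its set only if the set is bounded above; [sigma_max M] is such a bound. *)
  apply: ub_le_sup.
    exists (sigma_max M) => _ /= [x x1 <-].
    rewrite -(@ler_pXn2r _ 2)// ?nnegrE ?enorm_ge0//.
    rewrite enorm_sqr (le_trans (dot_mulmx_le_sigma_max M x))//.
    rewrite ler_piMr ?sqr_ge0// -enorm_sqr.
    by rewrite expr_le1// enorm_ge0.
  exists ((enorm v)^-1 *: v) => //=.
  by rewrite enormZ ger0_norm ?invr_ge0 ?enorm_ge0// mulVf// gt_eqF.
rewrite -scalemxAr enormZ ger0_norm ?invr_ge0 ?enorm_ge0// in key.
have sp0 : 0 <= spectral_norm M.
  by apply: le_trans key; rewrite mulr_ge0 ?invr_ge0 ?enorm_ge0.
rewrite -!enorm_sqr -exprMn ler_pXn2r ?nnegrE ?mulr_ge0 ?enorm_ge0//.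
by rewrite mulrC -ler_pdivrMl.
Qed.

Lemma dot_mulmx_le_lambda_max (A : 'M[R]_d) v :
  dot v (A *m v) *+ 2 <= lambda_max (A + A^T) * dot v v.
Proof.
have : (A + A^T)^T = A + A^T by rewrite linearD/= trmxK addrC.
move/rayleigh_le/(_ v); apply: le_trans.
by rewrite mulmxDl dotDr -dot_mulmxl (dotC (A *m v)) mulr2n.
Qed.

End norms.

(** Pythagoras: an orthogonal projector [p] satisfies [p^T p = p], whence
    [|v - p v|^2 = |v|^2 - |p v|^2]. *)
Lemma row_projector_le (R : realType) (k d : nat) (U : 'M[R]_(k, d)) v :
  U *m U^T = 1%:M ->
  dot (row_projector U *m v) (row_projector U *m v) <= dot v v.
Proof.
move=> U1.
have PP : (row_projector U)^T *m row_projector U = row_projector U.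
  by rewrite /row_projector trmx_mul trmxK mulmxA -(mulmxA U^T) U1 mulmx1.
have := dot_ge0 (v - row_projector U *m v).
rewrite !(dotDl, dotDr, dotNl, dotNr) (dotC v (row_projector U *m v)).
have -> : dot (row_projector U *m v) (row_projector U *m v)
    = dot (row_projector U *m v) v.
  by rewrite dot_mulmxl mulmxA PP dotC.
by lra.
Qed.

(** * Square-integrable random vectors *)

Section measurable_wrt.
Context (R : realType) d (T : measurableType d) (G : set (set T)).
Hypothesis sG : sigma_algebra setT G.
Implicit Types f g : T -> R.

(** A sigma-algebra generates itself, so the closure properties of [measurable_fun] become available
    on the type that carries [G]. *)
Lemma measurable_wrtP f :
  measurable_wrt G f <-> measurable_fun [set: g_sigma_algebraType G] f.
Proof.
have GE : <<s G >> = G by exact: sigma_algebra_id.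
split=> [mf _ D mD|mf D mD].
  by rewrite setTI /measurable/= GE; exact: mf.
by have := mf measurableT D mD; rewrite setTI /measurable/= GE.
Qed.

Lemma measurable_wrtD f g : measurable_wrt G f -> measurable_wrt G g ->
  measurable_wrt G (fun w => f w + g w).
Proof.
move=> /measurable_wrtP mf /measurable_wrtP mg; apply/measurable_wrtP.
exact: measurable_funD.
Qed.

Lemma measurable_wrtM f g : measurable_wrt G f -> measurable_wrt G g ->
  measurable_wrt G (fun w => f w * g w).
Proof.
move=> /measurable_wrtP mf /measurable_wrtP mg; apply/measurable_wrtP.
exact: measurable_funM.
Qed.

Lemma measurable_wrt_cst (c : R) : measurable_wrt G (fun=> c).
Proof. by apply/measurable_wrtP. Qed.

Lemma measurable_wrt_sum (I : Type) (r : seq I) (f : I -> T -> R) :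
  (forall i, measurable_wrt G (f i)) ->
  measurable_wrt G (fun w => \sum_(i <- r) f i w).
Proof.
move=> mf; elim: r => [|i r IH].
  rewrite (_ : (fun _ => _) = fun=> 0); first exact: measurable_wrt_cst.
  by apply/funext => w; rewrite big_nil.
rewrite (_ : (fun _ => _) = fun w => f i w + \sum_(j <- r) f j w).
  exact: measurable_wrtD.
by apply/funext => w; rewrite big_cons.
Qed.

End measurable_wrt.

Section expectation.
Context (R : realType) d (T : measurableType d) (P : probability T R).
Implicit Types f g : T -> R.

(** [fine] sends an infinite expectation to 0, so linearity and monotonicity are stated for
    functions in [Lfun P 1]. *)
Definition rexp f : R := fine ('E_P[f])%E.

Lemma rexpK f : f \in Lfun P 1 -> ('E_P[f])%E = (rexp f)%:E.
Proof. by move=> f1; rewrite /rexp fineK// expectation_fin_num. Qed.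

Lemma Lfun1D f g : f \in Lfun P 1 -> g \in Lfun P 1 ->
  (fun w => f w + g w) \in Lfun P 1.
Proof. by move=> f1 g1; have [_] := Lfun_addr_closed P (lexx 1%E); exact. Qed.

Lemma Lfun1Z (c : R) f : f \in Lfun P 1 -> (fun w => c * f w) \in Lfun P 1.
Proof.
move=> f1; rewrite (_ : (fun w => _) = c \o* f); last first.
  by apply/funext => w /=; rewrite mulrC.
exact: Lfun_scale.
Qed.

Lemma Lfun1_sum (I : Type) (r : seq I) (f : I -> T -> R) :
  (forall i, f i \in Lfun P 1) -> (fun w => \sum_(i <- r) f i w) \in Lfun P 1.
Proof.
move=> f1; elim: r => [|i r IH].
  rewrite (_ : (fun _ => _) = cst 0); first exact: Lfun_cst.
  by apply/funext => w; rewrite big_nil.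
rewrite (_ : (fun _ => _) = fun w => f i w + \sum_(j <- r) f j w).
  exact: Lfun1D.
by apply/funext => w; rewrite big_cons.
Qed.

Lemma Lfun2D f g : f \in Lfun P 2%:E -> g \in Lfun P 2%:E ->
  (fun w => f w + g w) \in Lfun P 2%:E.
Proof. by move=> f1 g1; have [_] := Lfun_addr_closed P (lee1n 2); exact. Qed.

Lemma Lfun2Z (c : R) f : f \in Lfun P 2%:E -> (fun w => c * f w) \in Lfun P 2%:E.
Proof.
move=> f1; rewrite (_ : (fun w => _) = c \o* f); last first.
  by apply/funext => w /=; rewrite mulrC.
by apply: Lfun_scale => //; rewrite ler1n.
Qed.

Lemma Lfun2_sum (I : Type) (r : seq I) (f : I -> T -> R) :
  (forall i, f i \in Lfun P 2%:E) ->
  (fun w => \sum_(i <- r) f i w) \in Lfun P 2%:E.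
Proof.
move=> f1; elim: r => [|i r IH].
  rewrite (_ : (fun _ => _) = cst 0); first exact: Lfun_cst.
  by apply/funext => w; rewrite big_nil.
rewrite (_ : (fun _ => _) = fun w => f i w + \sum_(j <- r) f j w).
  exact: Lfun2D.
by apply/funext => w; rewrite big_cons.
Qed.

Lemma rexpD f g : f \in Lfun P 1 -> g \in Lfun P 1 ->
  rexp (fun w => f w + g w) = rexp f + rexp g.
Proof.
by move=> f1 g1; rewrite /rexp expectationD// fineD ?expectation_fin_num.
Qed.

Lemma rexpZ (c : R) f : f \in Lfun P 1 -> rexp (fun w => c * f w) = c * rexp f.
Proof.
move=> f1; rewrite /rexp (_ : (fun w => c * f w) = c \o* f); last first.
  by apply/funext => w /=; rewrite mulrC.
by rewrite expectationZl// fineM ?expectation_fin_num.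
Qed.

Lemma rexp_sum (I : Type) (r : seq I) (f : I -> T -> R) :
  (forall i, f i \in Lfun P 1) ->
  rexp (fun w => \sum_(i <- r) f i w) = \sum_(i <- r) rexp (f i).
Proof.
move=> f1; elim: r => [|i r IH].
  rewrite big_nil (_ : (fun _ => _) = cst 0) /rexp ?expectation_cst//.
  by apply/funext => w; rewrite big_nil.
rewrite big_cons -IH -rexpD//; last exact: Lfun1_sum.
by congr rexp; apply/funext => w; rewrite big_cons.
Qed.

Lemma rexp_ge0 f : (forall w, 0 <= f w) -> 0 <= rexp f.
Proof. by move=> f0; rewrite /rexp fine_ge0// expectation_ge0. Qed.

Lemma rexp_le f g : f \in Lfun P 1 -> g \in Lfun P 1 ->
  (forall w, f w <= g w) -> rexp f <= rexp g.
Proof.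
move=> f1 g1 fg; rewrite -subr_ge0 -mulN1r -rexpZ// -rexpD//; last exact: Lfun1Z.
by apply: rexp_ge0 => w; rewrite mulN1r subr_ge0.
Qed.

Definition Lfun2v n (X : T -> 'cV[R]_n) := forall i, (fun w => X w i 0) \in Lfun P 2%:E.

Lemma Lfun2vD n (X Y : T -> 'cV[R]_n) :
  Lfun2v X -> Lfun2v Y -> Lfun2v (fun w => X w + Y w).
Proof.
move=> X2 Y2 i; rewrite (_ : (fun w => _) = fun w => X w i 0 + Y w i 0).
  exact: Lfun2D.
by apply/funext => w; rewrite mxE.
Qed.

Lemma Lfun2v_mulmx p n (M : 'M[R]_(p, n)) (X : T -> 'cV[R]_n) :
  Lfun2v X -> Lfun2v (fun w => M *m X w).
Proof.
move=> X2 i; rewrite (_ : (fun w => _) = fun w => \sum_j M i j * X w j 0).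
  by apply: Lfun2_sum => j; exact: Lfun2Z.
by apply/funext => w; rewrite mxE.
Qed.

Lemma Lfun2vZ n (c : R) (X : T -> 'cV[R]_n) :
  Lfun2v X -> Lfun2v (fun w => c *: X w).
Proof.
move=> X2; rewrite (_ : (fun w => _) = fun w => c%:M *m X w).
  exact: Lfun2v_mulmx.
by apply/funext => w; rewrite mul_scalar_mx.
Qed.

Lemma Lfun2v_sum n (I : finType) (X : I -> T -> 'cV[R]_n) :
  (forall i, Lfun2v (X i)) -> Lfun2v (fun w => \sum_i X i w).
Proof.
move=> X2 j; rewrite (_ : (fun w => _) = fun w => \sum_i X i w j 0).
  by apply: Lfun2_sum => i; exact: X2.
by apply/funext => w; rewrite summxE.
Qed.

Lemma Lfun1_dot n (X Y : T -> 'cV[R]_n) : Lfun2v X -> Lfun2v Y ->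
  (fun w => dot (X w) (Y w)) \in Lfun P 1.
Proof.
move=> X2 Y2; rewrite (_ : (fun w => _) = fun w => \sum_i X w i 0 * Y w i 0).
  by apply: Lfun1_sum => i; exact: Lfun2_mul_Lfun1.
by apply/funext => w; rewrite dotE.
Qed.

Section expectation_mx.
Context (p q : nat).
Implicit Types M N : T -> 'M[R]_(p, q).

Definition Lfun1mx M := forall i j, (fun w => M w i j) \in Lfun P 1.

Lemma expectation_mxD M N : Lfun1mx M -> Lfun1mx N ->
  expectation_mx P (fun w => M w + N w) = expectation_mx P M + expectation_mx P N.
Proof.
move=> M1 N1; apply/matrixP => i j; rewrite !mxE -[RHS]rexpD//.
by congr rexp; apply/funext => w; rewrite mxE.
Qed.

Lemma expectation_mxZ (c : R) M : Lfun1mx M ->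
  expectation_mx P (fun w => c *: M w) = c *: expectation_mx P M.
Proof.
move=> M1; apply/matrixP => i j; rewrite !mxE -[RHS]rexpZ//.
by congr rexp; apply/funext => w; rewrite mxE.
Qed.

Lemma expectation_mulmxr r (N : 'M[R]_(q, r)) M : Lfun1mx M ->
  expectation_mx P (fun w => M w *m N) = expectation_mx P M *m N.
Proof.
move=> M1; apply/matrixP => i j; rewrite !mxE.
transitivity (rexp (fun w => \sum_k N k j * M w i k)).
  by congr rexp; apply/funext => w; rewrite mxE; apply: eq_bigr => k _; rewrite mulrC.
rewrite rexp_sum => [|k]; last exact: Lfun1Z.
by apply: eq_bigr => k _; rewrite rexpZ// mxE mulrC.
Qed.

Lemma expectation_mulmxl r (N : 'M[R]_(r, p)) M : Lfun1mx M ->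
  expectation_mx P (fun w => N *m M w) = N *m expectation_mx P M.
Proof.
move=> M1; apply/matrixP => i j; rewrite !mxE.
transitivity (rexp (fun w => \sum_k N i k * M w k j)).
  by congr rexp; apply/funext => w; rewrite mxE.
rewrite rexp_sum => [|k]; last exact: Lfun1Z.
by apply: eq_bigr => k _; rewrite rexpZ// mxE.
Qed.

End expectation_mx.

Lemma Lfun1mxZ p q (c : R) (M : T -> 'M[R]_(p, q)) :
  Lfun1mx M -> Lfun1mx (fun w => c *: M w).
Proof.
move=> M1 i j; rewrite (_ : (fun w => _) = fun w => c * M w i j).
  exact: Lfun1Z.
by apply/funext => w; rewrite mxE.
Qed.

Lemma Lfun1mx_mulmxr p q r (N : 'M[R]_(q, r)) (M : T -> 'M[R]_(p, q)) :
  Lfun1mx M -> Lfun1mx (fun w => M w *m N).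
Proof.
move=> M1 i j; rewrite (_ : (fun w => _) = fun w => \sum_k N k j * M w i k).
  by apply: Lfun1_sum => l; exact: Lfun1Z.
by apply/funext => w; rewrite mxE; apply: eq_bigr => l _; rewrite mulrC.
Qed.
Lemma Lfun1mx_outer p q (X : T -> 'cV[R]_p) (Y : T -> 'cV[R]_q) :
  Lfun2v X -> Lfun2v Y -> Lfun1mx (fun w => X w *m (Y w)^T).
Proof.
move=> X2 Y2 i j; rewrite (_ : (fun w => _) = fun w => X w i 0 * Y w j 0).
  exact: Lfun2_mul_Lfun1.
by apply/funext => w; rewrite mxE big_ord1 mxE.
Qed.

Lemma rexp_dot n (X Y : T -> 'cV[R]_n) : Lfun2v X -> Lfun2v Y ->
  rexp (fun w => dot (X w) (Y w)) = \tr (expectation_mx P (fun w => X w *m (Y w)^T)).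
Proof.
move=> X2 Y2; rewrite /mxtrace.
transitivity (rexp (fun w => \sum_i X w i 0 * Y w i 0)).
  by congr rexp; apply/funext => w; rewrite dotE.
rewrite rexp_sum => [|i]; last exact: Lfun2_mul_Lfun1.
apply: eq_bigr => i _; rewrite mxE; congr rexp; apply/funext => w.
by rewrite mxE big_ord1 mxE.
Qed.

Lemma mean_squareE n (X : T -> 'cV[R]_n) : Lfun2v X ->
  mean_square P X = (rexp (fun w => dot (X w) (X w)))%:E.
Proof.
move=> X2; rewrite -rexpK; last exact: Lfun1_dot.
by rewrite /mean_square; congr expectation; apply/funext => w; rewrite enorm_sqr.
Qed.

(* The normal equation for [N] makes [N^T *m Z] the orthogonal projection of [G]
   onto the linear span of the components of [Z], hence shorter than [G]. *)
Lemma rexp_least_squares_le p n (Z : T -> 'cV[R]_p) (G : T -> 'cV[R]_n)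
    (N : 'M[R]_(p, n)) : Lfun2v Z -> Lfun2v G ->
  second_moment_mx P Z *m N = expectation_mx P (fun w => Z w *m (G w)^T) ->
  rexp (fun w => dot (N^T *m Z w) (N^T *m Z w)) <= rexp (fun w => dot (G w) (G w)).
Proof.
move=> Z2 G2 normal_eq.
pose X w := N^T *m Z w.
have X2 : Lfun2v X by exact: Lfun2v_mulmx.
(* The residual [G - X] is orthogonal to [X]: this is the trace of the normal equation multiplied by
   [N^T] on the left. *)
have XG : rexp (fun w => dot (X w) (X w)) = rexp (fun w => dot (X w) (G w)).
  rewrite !rexp_dot//.
  transitivity (\tr (N^T *m expectation_mx P (fun w => Z w *m (X w)^T))).
    rewrite -expectation_mulmxl; last exact: Lfun1mx_outer.
    by congr (\tr (expectation_mx _ _)); apply/funext => w; rewrite /X mulmxA.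
  transitivity (\tr (N^T *m expectation_mx P (fun w => Z w *m (G w)^T))).
    rewrite -normal_eq /second_moment_mx -expectation_mulmxr; last exact: Lfun1mx_outer.
    congr (\tr (N^T *m expectation_mx _ _)); apply/funext => w.
    by rewrite /X trmx_mul trmxK mulmxA.
  rewrite -expectation_mulmxl; last exact: Lfun1mx_outer.
  by congr (\tr (expectation_mx _ _)); apply/funext => w; rewrite /X mulmxA.
(* Together with [XG] this integrates to [2 E|X|^2 <= E|X|^2 + E|G|^2]. *)
have le w : 2 * dot (X w) (G w) <= dot (X w) (X w) + dot (G w) (G w).
  have := dot_ge0 (X w - G w).
  by rewrite !(dotDl, dotDr, dotNl, dotNr) (dotC (G w)); lra.
have L1 : (fun w => dot (X w) (X w)) \in Lfun P 1 by exact: Lfun1_dot.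
have L2 : (fun w => dot (G w) (G w)) \in Lfun P 1 by exact: Lfun1_dot.
have L3 : (fun w => dot (X w) (G w)) \in Lfun P 1 by exact: Lfun1_dot.
have := rexp_le (Lfun1Z 2 L3) (Lfun1D L1 L2) le.
by rewrite rexpZ// rexpD// -XG -/X; move: (rexp _) (rexp _) => a b; lra.
Qed.

End expectation.

(** * Gaussian increments *)

Section increments.
Context (R : realType) d (T : measurableType d) (P : probability T R).
Variables (G : set (set T)) (m : nat) (dW : 'I_m -> T -> R) (dt : R).
Hypotheses (sG : sigma_algebra setT G) (Gm : G `<=` measurable) (dt0 : 0 < dt).
Hypothesis dWm : forall i, measurable_fun [set: T] (dW i).
Hypothesis dWN : forall i (D : set R), measurable D ->
  P (dW i @^-1` D) = normal_prob 0 (Num.sqrt dt) D.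
Hypothesis dWG : forall E, G E -> forall D : 'I_m -> set R,
  (forall i, measurable (D i)) ->
  P (E `&` \bigcap_(i in [set: 'I_m]) (dW i @^-1` D i)) =
  (P E * \prod_(i < m) P (dW i @^-1` D i))%E.

Lemma measurable_wrt_measurable (Z : T -> R) :
  measurable_wrt G Z -> measurable_fun [set: T] Z.
Proof. by move=> mZ _ D mD; rewrite setTI; exact/Gm/mZ. Qed.

Let mfunP (Z : T -> R) : measurable_fun [set: T] Z ->
  exists Z' : {mfun T >-> R}, Z' = Z :> (T -> R).
Proof. by move=> mZ; exists (mfun_Sub (mem_set mZ)). Qed.

(** The increments other than [i] are constrained by [setT] only, which contributes factors 1. *)
Let indep1 E i (B : set R) : G E -> measurable B ->
  P (E `&` dW i @^-1` B) = (P E * P (dW i @^-1` B))%E.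
Proof.
move=> GE mB; have := dWG GE (D := fun k => if k == i then B else setT).
move=> /(_ (fun k => ltac:(by case: ifP))).
rewrite (bigD1 i)//= eqxx big1 => [|k /negbTE ->]; last first.
  by rewrite preimage_setT probability_setT.
rewrite mule1 => <-; congr (P (_ `&` _)); apply/seteqP; split => w /=.
  by move=> Bw k _; rewrite /preimage/=; case: eqVneq => // ->.
by move=> /(_ i I); rewrite /= eqxx.
Qed.

Let indep2 E i j (B C : set R) : i != j -> G E -> measurable B -> measurable C ->
  P (E `&` dW i @^-1` B `&` dW j @^-1` C) =
  (P E * P (dW i @^-1` B) * P (dW j @^-1` C))%E.
Proof.
move=> ij GE mB mC.
pose D k := if k == i then B else if k == j then C else setT.
have mD k : measurable (D k) by rewrite /D; case: ifP => // _; case: ifP.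
have Di : D i = B by rewrite /D eqxx.
have Dj : D j = C by rewrite /D eqxx eq_sym (negbTE ij).
have := dWG GE mD; rewrite (bigD1 i)//= (bigD1 j) ?(eq_sym j)//= Di Dj.
rewrite big1 => [|k /andP[/negbTE ki /negbTE kj]]; last first.
  by rewrite /D ki kj preimage_setT probability_setT.
rewrite mule1 muleA => <-; rewrite -setIA; congr (P (_ `&` _)).
apply/seteqP; split => w /=.
  move=> [Bw Cw] k _; rewrite /preimage/= /D.
  by case: eqVneq => [->//|_]; case: eqVneq => [->|].
by move=> h; split; [have := h i I|have := h j I]; rewrite /= ?Di ?Dj.
Qed.

Lemma increment_independent (Z : T -> R) i :
  measurable_wrt G Z -> independent_rv P Z (dW i).
Proof. by move=> mZ A B mA mB; rewrite indep1//; exact: mZ. Qed.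

Lemma increment_independentM (Z : T -> R) i j : i != j ->
  measurable_wrt G Z -> independent_rv P (fun w => Z w * dW i w) (dW j).
Proof.
move=> ij mZ.
have [Z' ZE] := mfunP (measurable_wrt_measurable mZ).
have [V VE] := mfunP (dWm i); have [V' VE'] := mfunP (dWm j).
rewrite -ZE -VE -VE'; apply: independent_rvM => A B C mA mB mC.
by rewrite ZE VE VE' indep2//; exact: mZ.
Qed.

Let s0 : 0 < Num.sqrt dt. Proof. by rewrite sqrtr_gt0. Qed.

Lemma increment_Lfun1 i : dW i \in Lfun P 1.
Proof.
apply: Lfun_subset12; first exact: fin_num_measure.
exact: (normal_Lfun2 s0 (dWm i) (dWN i)).
Qed.

Let mean0 i : (\int[P]_w (dW i w)%:E)%E = 0%E.
Proof. exact: (normal_mean0 s0 (dWm i) (dWN i)). Qed.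

Let rexp_mul0 (Z : T -> R) i : measurable_fun [set: T] Z ->
  Z \in Lfun P 1 -> independent_rv P Z (dW i) ->
  (fun w => Z w * dW i w) \in Lfun P 1 /\ rexp P (fun w => Z w * dW i w) = 0.
Proof.
move=> mZ Z1 ZdW.
have [Z' ZE] := mfunP mZ; have [V VE] := mfunP (dWm i).
have [] := @integral_indep _ _ _ P Z' V.
- by rewrite ZE VE.
- by rewrite ZE; exact/Lfun1_integrable.
- by rewrite VE; apply/Lfun1_integrable; exact: increment_Lfun1.
rewrite ZE VE mean0 mule0 => i1 e0; split; first exact/Lfun1_integrable.
by rewrite /rexp unlock e0.
Qed.

Lemma rexp_increment (Z : T -> R) i : measurable_wrt G Z -> Z \in Lfun P 1 ->
  (fun w => Z w * dW i w) \in Lfun P 1 /\ rexp P (fun w => Z w * dW i w) = 0.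
Proof.
move=> mZ Z1; apply: rexp_mul0 => //; first exact: measurable_wrt_measurable.
exact: increment_independent.
Qed.

(** The product is grouped as [Z * dW i] times [dW j]: the first factor is integrable and
    independent of the second, which is centered. *)
Lemma rexp_increment2 (Z : T -> R) i j : i != j ->
  measurable_wrt G Z -> Z \in Lfun P 1 ->
  rexp P (fun w => Z w * dW i w * dW j w) = 0.
Proof.
move=> ij mZ Z1; have [ZW1 _] := rexp_increment i mZ Z1.
have [|||//] := @rexp_mul0 (fun w => Z w * dW i w) j.
- by apply: measurable_funM; [exact: measurable_wrt_measurable|exact: dWm].
- exact: ZW1.
- exact: increment_independentM.
Qed.

Lemma ge0_integral_increment_sqr_le (Z : T -> R) i : measurable_wrt G Z ->
  (forall w, 0 <= Z w) ->
  (\int[P]_w (Z w * dW i w ^+ 2)%:E <= \int[P]_w (Z w)%:E * dt%:E)%E.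
Proof.
move=> mZ Z0.
have [Z' ZE] := mfunP (measurable_wrt_measurable mZ); have [V VE] := mfunP (dWm i).
have ind : independent_rv P Z' V by rewrite ZE VE; exact: increment_independent.
(* [ge0_integral_indep] asks for functions nonnegative on all of [R], hence the absolute value,
   which is harmless as [Z] is nonnegative. *)
have := ge0_integral_indep ind (f := fun x => `|x|%:E) (g := fun x => (x ^+ 2)%:E).
rewrite ZE VE => e.
have -> : (\int[P]_w (Z w * dW i w ^+ 2)%:E =
           \int[P]_w (`|Z w|%:E * (dW i w ^+ 2)%:E))%E.
  by apply: eq_integral => w _; rewrite ger0_norm// EFinM.
rewrite e//.
- have -> : (\int[P]_w `|Z w|%:E = \int[P]_w (Z w)%:E)%E.
    by apply: eq_integral => w _; rewrite ger0_norm.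
  apply: lee_wpmul2l; first by rewrite integral_ge0// => w _; rewrite lee_fin.
  have := normal_sqr_le s0 (dWm i) (dWN i).
  by rewrite sqr_sqrtr// ltW.
- apply/measurable_EFinP; exact: normr_measurable.
- by apply/measurable_EFinP; exact: measurable_funX.
- by move=> x; rewrite lee_fin sqr_ge0.
Qed.

Lemma rexp_increment_sqr_le (Z : T -> R) i : measurable_wrt G Z ->
  Z \in Lfun P 1 -> (forall w, 0 <= Z w) ->
  rexp P (fun w => Z w * dW i w ^+ 2) <= dt * rexp P Z.
Proof.
move=> mZ Z1 Z0.
have le := ge0_integral_increment_sqr_le i mZ Z0.
have := rexpK Z1; rewrite unlock => ZE; rewrite ZE -EFinM mulrC in le.
rewrite {1}/rexp unlock -lee_fin.
rewrite fineK; first exact: le.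
rewrite ge0_fin_numE; first exact: le_lt_trans le (ltry _).
by rewrite integral_ge0// => w _; rewrite lee_fin mulr_ge0// sqr_ge0.
Qed.

(** By independence [E[Z^2 W_i^2] <= dt E[Z^2]], so second moments suffice where the Cauchy-Schwarz
    inequality would ask for fourth ones. *)
Lemma Lfun2_increment (Z : T -> R) i : measurable_wrt G Z ->
  Z \in Lfun P 2%:E -> (fun w => dW i w * Z w) \in Lfun P 2%:E.
Proof.
move=> mZ Z2.
have ZZ0 w : 0 <= Z w * Z w by rewrite -expr2 sqr_ge0.
have mZ' := measurable_wrt_measurable mZ.
apply: sqr_integrable_Lfun2; first exact: measurable_funM.
apply: le_lt_trans (_ : ((\int[P]_w (Z w * Z w)%:E * dt%:E) < +oo)%E).
  apply: le_trans (ge0_integral_increment_sqr_le i (measurable_wrtM sG mZ mZ) ZZ0).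
  rewrite le_eqVlt; apply/orP; left; apply/eqP; apply: eq_integral => w _.
  by rewrite exprMn mulrC expr2.
have iZ : (\int[P]_w (Z w * Z w)%:E)%E \is a fin_num.
  by apply: integrable_fin_num => //; apply/Lfun1_integrable/Lfun2_mul_Lfun1.
rewrite lte_mul_pinfty ?ltry// integral_ge0// => w _.
by rewrite lee_fin.
Qed.

End increments.

(** * One step of the scheme *)

Section measurable_wrt_vector.
Context (R : realType) d (T : measurableType d) (G : set (set T)).
Hypothesis sG : sigma_algebra setT G.

Definition measurable_wrtv n (X : T -> 'cV[R]_n) : Prop :=
  forall i, measurable_wrt G (fun w => X w i 0).

Lemma measurable_wrtvD n (X Y : T -> 'cV[R]_n) :
  measurable_wrtv X -> measurable_wrtv Y -> measurable_wrtv (fun w => X w + Y w).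
Proof.
move=> mX mY i; rewrite (_ : (fun w => _) = fun w => X w i 0 + Y w i 0).
  exact: measurable_wrtD.
by apply/funext => w; rewrite mxE.
Qed.

Lemma measurable_wrtv_mulmx p n (M : 'M[R]_(p, n)) (X : T -> 'cV[R]_n) :
  measurable_wrtv X -> measurable_wrtv (fun w => M *m X w).
Proof.
move=> mX i; rewrite (_ : (fun w => _) = fun w => \sum_j M i j * X w j 0).
  apply: measurable_wrt_sum => // j.
  by apply: measurable_wrtM => //; exact: measurable_wrt_cst.
by apply/funext => w; rewrite mxE.
Qed.

Lemma measurable_wrtvZ n (f : T -> R) (X : T -> 'cV[R]_n) :
  measurable_wrt G f -> measurable_wrtv X ->
  measurable_wrtv (fun w => f w *: X w).
Proof.
move=> mf mX i; rewrite (_ : (fun w => _) = fun w => f w * X w i 0).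
  exact: measurable_wrtM.
by apply/funext => w; rewrite mxE.
Qed.

Lemma measurable_wrtv_sum n (I : finType) (X : I -> T -> 'cV[R]_n) :
  (forall i, measurable_wrtv (X i)) -> measurable_wrtv (fun w => \sum_i X i w).
Proof.
move=> mX j; rewrite (_ : (fun w => _) = fun w => \sum_i X i w j 0).
  by apply: measurable_wrt_sum => // i; exact: mX.
by apply/funext => w; rewrite summxE.
Qed.

Lemma measurable_wrt_dot n (X Y : T -> 'cV[R]_n) :
  measurable_wrtv X -> measurable_wrtv Y ->
  measurable_wrt G (fun w => dot (X w) (Y w)).
Proof.
move=> mX mY; rewrite (_ : (fun w => _) = fun w => \sum_i X w i 0 * Y w i 0).
  by apply: measurable_wrt_sum => // i; exact: measurable_wrtM.
by apply/funext => w; rewrite dotE.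
Qed.

End measurable_wrt_vector.

Lemma dot_sumr (R : realType) n (I : Type) (r : seq I)
    (u : 'cV[R]_n) (v : I -> 'cV[R]_n) :
  dot u (\sum_(i <- r) v i) = \sum_(i <- r) dot u (v i).
Proof. by rewrite /dot mulmx_sumr summxE. Qed.

Lemma dot_suml (R : realType) n (I : Type) (r : seq I)
    (u : I -> 'cV[R]_n) (v : 'cV[R]_n) :
  dot (\sum_(i <- r) u i) v = \sum_(i <- r) dot (u i) v.
Proof. by rewrite dotC dot_sumr; apply: eq_bigr => i _; rewrite dotC. Qed.

(** In the expanded square the term of order [dt] is the quadratic form of [A + A^T] and the term of
    order [dt ^+ 2] is [|A x|^2]; this is where the drift part of the growth factor comes from. *)
Lemma dot_euler_drift_le (R : realType) n (A : 'M[R]_n) (dt : R) (x : 'cV[R]_n) :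
  0 < dt -> dot (x + dt *: (A *m x)) (x + dt *: (A *m x)) <=
  (1 + lambda_max (A + A^T) * dt + sigma_max A ^+ 2 * dt ^+ 2) * dot x x.
Proof.
move=> dt0; rewrite !(dotDl, dotDr, dotZl, dotZr) (dotC (A *m x) x).
have := ler_wpM2l (ltW dt0) (dot_mulmx_le_lambda_max A x).
have := ler_wpM2l (sqr_ge0 dt) (dot_mulmx_le_sigma_max A x).
move: (lambda_max _) (sigma_max A ^+ 2) (dot x x) (dot x (A *m x))
  (dot (A *m x) (A *m x)).
by move=> l s xx xa aa; lra.
Qed.

Section step.
Context (R : realType) disp (T : measurableType disp) (P : probability T R).
Variables (G : set (set T)) (m d k : nat) (dW : 'I_m -> T -> R) (dt : R).
Variables (A : 'M[R]_d) (B : 'I_m -> 'M[R]_d).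
Hypotheses (sG : sigma_algebra setT G) (Gm : G `<=` measurable) (dt0 : 0 < dt).
Hypothesis dWm : forall i, measurable_fun [set: T] (dW i).
Hypothesis dWN : forall i (D : set R), measurable D ->
  P (dW i @^-1` D) = normal_prob 0 (Num.sqrt dt) D.
Hypothesis dWG : forall E, G E -> forall D : 'I_m -> set R,
  (forall i, measurable (D i)) ->
  P (E `&` \bigcap_(i in [set: 'I_m]) (dW i @^-1` D i)) =
  (P E * \prod_(i < m) P (dW i @^-1` D i))%E.

Section noise.
Variable X : T -> 'cV[R]_d.
Hypotheses (mX : measurable_wrtv G X) (X2 : Lfun2v P X).

Let noise w := \sum_(i < m) dW i w *: (B i *m X w).

Let Lfun2v_noise_term i : Lfun2v P (fun w => dW i w *: (B i *m X w)).
Proof.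
move=> j; rewrite (_ : (fun w => _) = fun w => dW i w * (B i *m X w) j 0).
  apply: (Lfun2_increment sG Gm dt0 dWm dWN dWG).
    exact: measurable_wrtv_mulmx.
  exact: Lfun2v_mulmx.
by apply/funext => w; rewrite mxE.
Qed.

Lemma Lfun2v_noise : Lfun2v P noise.
Proof. by apply: Lfun2v_sum => i; exact: Lfun2v_noise_term. Qed.

Lemma rexp_dot_noise (V : T -> 'cV[R]_d) : measurable_wrtv G V -> Lfun2v P V ->
  rexp P (fun w => dot (V w) (noise w)) = 0.
Proof.
move=> mV V2.
have h i : (fun w => dot (V w) (B i *m X w) * dW i w) \in Lfun P 1 /\
    rexp P (fun w => dot (V w) (B i *m X w) * dW i w) = 0.
  apply: (rexp_increment Gm dt0 dWm dWN dWG).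
    by apply: measurable_wrt_dot => //; exact: measurable_wrtv_mulmx.
  by apply: Lfun1_dot => //; exact: Lfun2v_mulmx.
transitivity (rexp P (fun w => \sum_i dot (V w) (B i *m X w) * dW i w)).
  congr rexp; apply/funext => w; rewrite dot_sumr; apply: eq_bigr => i _.
  by rewrite dotZr mulrC.
rewrite rexp_sum => [|i]; last by have [] := h i.
by apply: big1 => i _; have [] := h i.
Qed.

(** In the double sum the off-diagonal terms have mean 0, and the diagonal ones are at most
    [dt E|B_i X|^2]. *)
Lemma rexp_noise_sqr_le : rexp P (fun w => dot (noise w) (noise w)) <=
  (\sum_(i < m) spectral_norm (B i) ^+ 2 * dt) * rexp P (fun w => dot (X w) (X w)).
Proof.
have BX2 i : Lfun2v P (fun w => B i *m X w) by exact: Lfun2v_mulmx.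
have mBX i : measurable_wrtv G (fun w => B i *m X w) by exact: measurable_wrtv_mulmx.
have X1 : (fun w => dot (X w) (X w)) \in Lfun P 1 by exact: Lfun1_dot.
apply: (@le_trans _ _ (\sum_i \sum_j
    rexp P (fun w => dot (dW i w *: (B i *m X w)) (dW j w *: (B j *m X w))))).
  rewrite le_eqVlt; apply/orP; left; apply/eqP.
  transitivity (rexp P (fun w => \sum_i \sum_j
      dot (dW i w *: (B i *m X w)) (dW j w *: (B j *m X w)))).
    congr rexp; apply/funext => w; rewrite dot_suml; apply: eq_bigr => i _.
    by rewrite dot_sumr.
  rewrite rexp_sum => [|i]; last by apply: Lfun1_sum => j; exact: Lfun1_dot.
  apply: eq_bigr => i _; rewrite rexp_sum => [//|j]; exact: Lfun1_dot.
rewrite mulr_suml; apply: ler_sum => i _.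
rewrite (bigD1 i)//= big1 => [|j ji]; last first.
  transitivity (rexp P (fun w => dot (B i *m X w) (B j *m X w) * dW i w * dW j w)).
    by congr rexp; apply/funext => w; rewrite dotZl dotZr; ring.
  apply: (rexp_increment2 Gm dt0 dWm dWN dWG); first by rewrite eq_sym.
  - exact: measurable_wrt_dot.
  - exact: Lfun1_dot.
rewrite addr0.
have -> : rexp P (fun w => dot (dW i w *: (B i *m X w)) (dW i w *: (B i *m X w)))
   = rexp P (fun w => dot (B i *m X w) (B i *m X w) * dW i w ^+ 2).
  by congr rexp; apply/funext => w; rewrite dotZl dotZr; ring.
apply: (@le_trans _ _ (dt * rexp P (fun w => dot (B i *m X w) (B i *m X w)))).
  apply: (rexp_increment_sqr_le Gm dt0 dWm dWN dWG).
  - exact: measurable_wrt_dot.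
  - exact: Lfun1_dot.
  - by move=> w; exact: dot_ge0.
rewrite mulrAC [leRHS]mulrC ler_wpM2l ?(ltW dt0)// -rexpZ//.
apply: rexp_le; [exact: Lfun1_dot|exact: Lfun1Z|move=> w].
exact: dot_mulmx_le_spectral_norm.
Qed.

End noise.

(** Orthonormality and square integrability of the new pair are returned with the energy bound
    because the next step asks for them. *)
Lemma dlr_stepP (U U' : 'M[R]_(k, d)) (Y Y' : T -> 'cV[R]_k) :
  U *m U^T = 1%:M -> measurable_wrtv G Y -> Lfun2v P Y ->
  dlr_step P A B dt dW U Y U' Y' ->
  [/\ U' *m U'^T = 1%:M, Lfun2v P Y' &
    rexp P (fun w => dot (U'^T *m Y' w) (U'^T *m Y' w)) <=
    growth_factor A B dt * rexp P (fun w => dot (U^T *m Y w) (U^T *m Y w))].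
Proof.
move=> U1 mY Y2 [Ut [Q [[normal_eq _] [UtE U'1 _] Y'E]]].
pose X w := U^T *m Y w.
have X2 : Lfun2v P X by exact: Lfun2v_mulmx.
have mX : measurable_wrtv G X by exact: measurable_wrtv_mulmx.
pose b w := \sum_(i < m) dW i w *: (B i *m X w).
have b2 : Lfun2v P b by exact: Lfun2v_noise.
pose Yt w := Y w + dt *: (U *m (A *m X w)) + U *m b w.
have Yt2 : Lfun2v P Yt.
  apply: Lfun2vD; last exact: Lfun2v_mulmx.
  by apply: Lfun2vD => //; apply: Lfun2vZ; do 2 apply: Lfun2v_mulmx.
have AX2 : Lfun2v P (fun w => A *m X w) by exact: Lfun2v_mulmx.
pose Pr := row_projector U.
pose a w := X w + dt *: (A *m X w).
have a2 : Lfun2v P a by apply: Lfun2vD => //; exact: Lfun2vZ.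
have ma : measurable_wrtv G a.
  apply: measurable_wrtvD => //; apply: measurable_wrtvZ => //.
    exact: measurable_wrt_cst.
  exact: measurable_wrtv_mulmx.
pose V w := a w + Pr *m b w.
have V2 : Lfun2v P V by apply: Lfun2vD => //; exact: Lfun2v_mulmx.
have PrT : Pr^T = Pr by rewrite /Pr /row_projector trmx_mul trmxK.
(* The part of the drift that [Pr] removes in [U^T *m Yt] is put back, so that in [V] the projector
   acts on the noise only. *)
have VE w : V w = U^T *m Yt w + dt *: ((1%:M - Pr) *m (A *m X w)).
  have -> : U^T *m Yt w = X w + dt *: (Pr *m (A *m X w)) + Pr *m b w.
    by rewrite /Yt !mulmxDr -scalemxAr !mulmxA.
  rewrite /V /a mulmxBl mul1mx scalerBr.
  move: (X w) (dt *: (A *m X w)) (dt *: (Pr *m _)) (Pr *m b w) => x y z t.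
  by apply/matrixP => i j; rewrite !mxE; ring.
(* The deterministic factors [U] and [1%:M - Pr] go under the expectation; as [1%:M - Pr] is
   symmetric, the equation for [Ut] has the cross moment of [Yt] and [V] on its right. *)
have normal : second_moment_mx P Yt *m Ut =
    expectation_mx P (fun w => Yt w *m (V w)^T).
  rewrite normal_eq /second_moment_mx.
  have -> : (fun w => Yt w *m (V w)^T) = (fun w => Yt w *m (Yt w)^T *m U +
      dt *: (Yt w *m (A *m X w)^T *m (1%:M - Pr))).
    apply/funext => w; rewrite VE linearD/= linearZ/= [LHS]mulmxDr -scalemxAr.
    by rewrite !trmx_mul trmxK linearB/= trmx1 PrT !mulmxA.
  have YA1 : Lfun1mx P (fun w => Yt w *m (A *m X w)^T) by exact: Lfun1mx_outer.
  have YY1 : Lfun1mx P (fun w => Yt w *m (Yt w)^T) by exact: Lfun1mx_outer.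
  rewrite expectation_mxD.
  - rewrite expectation_mulmxr// expectation_mxZ ?expectation_mulmxr//.
    exact: Lfun1mx_mulmxr.
  - exact: Lfun1mx_mulmxr.
  - by apply: Lfun1mxZ; exact: Lfun1mx_mulmxr.
have E1 : rexp P (fun w => dot (U'^T *m Y' w) (U'^T *m Y' w)) <=
    rexp P (fun w => dot (V w) (V w)).
  rewrite (_ : (fun w => dot (U'^T *m _) _) =
    fun w => dot (Ut^T *m Yt w) (Ut^T *m Yt w)); last first.
    by apply/funext => w; rewrite Y'E UtE mulmxA.
  exact: rexp_least_squares_le.
split => //.
  rewrite (_ : Y' = fun w => Q *m Yt w); first exact: Lfun2v_mulmx.
  by apply/funext => w; rewrite Y'E.
apply: (le_trans E1).
pose N w := dot (X w) (X w).
have N1 : (fun w => N w) \in Lfun P 1 by exact: Lfun1_dot.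
have b1 : (fun w => dot (b w) (b w)) \in Lfun P 1 by exact: Lfun1_dot.
pose c := 1 + lambda_max (A + A^T) * dt + sigma_max A ^+ 2 * dt ^+ 2.
have mPa : measurable_wrtv G (fun w => Pr *m a w) by exact: measurable_wrtv_mulmx.
have Pa2 : Lfun2v P (fun w => Pr *m a w) by exact: Lfun2v_mulmx.
have ab1 : (fun w => dot (Pr *m a w) (b w)) \in Lfun P 1 by exact: Lfun1_dot.
(* In the cross term the projector is moved from [b] to [a], which pairs the noise with a
   [G]-measurable vector and makes the mean vanish; in the quadratic term it is bounded away. *)
apply: (@le_trans _ _ (rexp P (fun w =>
    (c * N w + 2 * dot (Pr *m a w) (b w)) + dot (b w) (b w)))).
  apply: rexp_le; first exact: Lfun1_dot.
    by do 2 (apply: Lfun1D => //); exact: Lfun1Z.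
  move=> w; rewrite /V.
  have := dot_euler_drift_le A (X w) dt0; rewrite -/(a w) -/c -/(N w).
  have := row_projector_le (b w) U1; rewrite -/Pr.
  have : dot (a w) (Pr *m b w) = dot (Pr *m a w) (b w).
    by rewrite dot_mulmxl PrT.
  move: (a w) (b w) (N w) => x y n.
  by rewrite !(dotDl, dotDr) (dotC (Pr *m y) x); lra.
rewrite rexpD//; last by apply: Lfun1D; exact: Lfun1Z.
rewrite rexpD ?rexpZ//; try exact: Lfun1Z.
rewrite rexp_dot_noise// mulr0 addr0 /growth_factor -/c [leRHS]mulrDl lerD2l.
exact: rexp_noise_sqr_le.
Qed.

(** [G'] stands for the sigma-algebra at the end of the step, where the increments are measurable,
    whereas the energy estimate conditions on the one at its beginning. *)
Lemma dlr_step_measurable (G' : set (set T)) (U U' : 'M[R]_(k, d))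
    (Y Y' : T -> 'cV[R]_k) :
  sigma_algebra setT G' -> measurable_wrtv G' Y ->
  (forall i, measurable_wrt G' (dW i)) ->
  dlr_step P A B dt dW U Y U' Y' -> measurable_wrtv G' Y'.
Proof.
move=> sG' mY mdW [Ut [Q [_ _ Y'E]]].
pose X w := U^T *m Y w.
have mX : measurable_wrtv G' X by exact: measurable_wrtv_mulmx.
rewrite (_ : Y' = fun w => Q *m (Y w + dt *: (U *m (A *m X w))
    + U *m (\sum_(i < m) dW i w *: (B i *m X w)))).
  apply: (measurable_wrtv_mulmx sG'); apply: (measurable_wrtvD sG').
    apply: (measurable_wrtvD sG') => //; apply: (measurable_wrtvZ sG').
      exact: measurable_wrt_cst.
    by do 2 (apply: (measurable_wrtv_mulmx sG')).
  apply: (measurable_wrtv_mulmx sG'); apply: (measurable_wrtv_sum sG') => i.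
  by apply: (measurable_wrtvZ sG') => //; exact: measurable_wrtv_mulmx.
by apply/funext => w; exact: Y'E.
Qed.

End step.

(** * Stability *)

Section scheme.
Context (R : realType) (disp : measure_display)
    (Omega : measurableType disp) (P : probability Omega R)
    (F : R -> set (set Omega)) (m d k : nat)
    (W : 'I_m -> R -> Omega -> R)
    (A : R -> 'M[R]_d) (B : 'I_m -> R -> 'M[R]_d) (t : nat -> R).
Hypotheses (usualF : usual_conditions P F) (brownianW : brownian_motion P F W).
Hypotheses (t_start : t 0%N = 0) (t_incr : forall n, t n < t n.+1).
Variables (U : nat -> 'M[R]_(k, d)) (Y : nat -> Omega -> 'cV[R]_k).
Hypothesis run : dlr_scheme P F W A B t U Y.

Let t_ge0 n : 0 <= t n.
Proof. by elim: n => [|n IH]; rewrite ?t_start// (le_trans IH)// ltW. Qed.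

Let growth n : R :=
  growth_factor (A (t n)) (fun i => B i (t n)) (t n.+1 - t n).

Let energy n := rexp P (fun w => dot (dlr_approx U Y n w) (dlr_approx U Y n w)).

Let sF n : sigma_algebra setT (F (t n)).
Proof. exact: (uc_sigma_algebra usualF (t_ge0 n)). Qed.

Let Fm n : F (t n) `<=` measurable.
Proof. exact: (uc_measurable usualF (t_ge0 n)). Qed.

Let mW n i : measurable_wrt (F (t n)) (W i (t n)).
Proof. exact: (bm_adapted brownianW). Qed.

Let mW_next n i : measurable_wrt (F (t n.+1)) (W i (t n)).
Proof.
move=> D mD; apply: (uc_mono usualF (t_ge0 n) (ltW (t_incr n))).
exact: mW.
Qed.

Let mdW n i : measurable_fun [set: Omega] (fun w => W i (t n.+1) w - W i (t n) w).
Proof.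
apply: measurable_funB.
  exact: (measurable_wrt_measurable (@Fm n.+1) (mW n.+1 i)).
exact: (measurable_wrt_measurable (@Fm n) (mW n i)).
Qed.

(** The first three claims are what the one-step estimate at [n] requires, the fourth is what it
    yields; the induction therefore passes on only the first three. *)
Let dlr_invariant n : [/\ U n *m (U n)^T = 1%:M,
  measurable_wrtv (F (t n)) (Y n), Lfun2v P (Y n) &
  energy n.+1 <= growth n * energy n].
Proof.
case: run => U0 mY0 Y02 step.
have dt0 j : 0 < t j.+1 - t j by rewrite subr_gt0.
have stepP j := @dlr_stepP R disp Omega P (F (t j)) m d k
  (fun i w => W i (t j.+1) w - W i (t j) w) (t j.+1 - t j)
  (A (t j)) (fun i => B i (t j)) (@sF j) (@Fm j) (dt0 j) (@mdW j)
  (fun i D mD => bm_gaussian brownianW i (t_ge0 j) (t_incr j) mD)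
  (bm_independent brownianW (t_ge0 j) (t_incr j)).
elim: n => [|n [Un mYn Yn2 _]].
  have mY : measurable_wrtv (F (t 0%N)) (Y 0%N) by move=> j; rewrite t_start.
  by split => //; have [] := stepP 0%N _ _ _ _ U0 mY Y02 (step 0%N).
have [Un' Yn2' _] := stepP n _ _ _ _ Un mYn Yn2 (step n).
have mYn' : measurable_wrtv (F (t n.+1)) (Y n.+1).
  apply: (dlr_step_measurable (@sF n.+1) _ _ (step n)).
    move=> j D mD; apply: (uc_mono usualF (t_ge0 n) (ltW (t_incr n))).
    exact: mYn.
  move=> i; rewrite (_ : (fun w => _) =
      fun w => W i (t n.+1) w + (-1) * W i (t n) w); last first.
    by apply/funext => w; rewrite mulN1r.
  apply: (measurable_wrtD (@sF n.+1)); first exact: mW.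
  by apply: (measurable_wrtM (@sF n.+1)) => //; exact: measurable_wrt_cst.
by split => //; have [] := stepP n.+1 _ _ _ _ Un' mYn' Yn2' (step n.+1).
Qed.

Let energy_ge0 n : 0 <= energy n.
Proof. by apply: rexp_ge0 => w; exact: dot_ge0. Qed.

(** Since the energy is nonnegative, each factor may be replaced by its absolute value, and the
    inequalities can then be multiplied whatever the sign of the factors. *)
Let energy_le n : energy n <= \prod_(j < n) `|growth j| * energy 0%N.
Proof.
elim: n => [|n IH]; first by rewrite big_ord0 mul1r.
have [_ _ _ /le_trans] := dlr_invariant n; apply.
apply: (@le_trans _ _ (`|growth n| * energy n)).
  by rewrite ler_wpM2r ?ler_norm.
by rewrite big_ord_recr/= mulrAC [leRHS]mulrC ler_wpM2l.
Qed.

(** A run enters the bound only through its initial value [e 0], which makes the stability estimate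
    uniform over runs. *)
Lemma mean_square_dlr : exists e : nat -> R,
  (forall n, mean_square P (dlr_approx U Y n) = (e n)%:E) /\
  (forall n, 0 <= e n <= \prod_(j < n) `|growth_factor (A (t j))
     (fun i => B i (t j)) (t j.+1 - t j)| * e 0%N).
Proof.
exists energy; split=> n; last by rewrite energy_ge0 energy_le.
have [_ _ Y2 _] := dlr_invariant n.
by rewrite mean_squareE//; exact: Lfun2v_mulmx.
Qed.

End scheme.

(* growth_lt1 alone does not give E|X_n|^2 --> 0 when the coefficients or the
   steps vary with n: with d = k = 1, t n = n, B = 0 and
   A t = - (t + 2) ^- 2 it holds, but X_n = (n + 2) / (2 (n + 1)) X_0. Hence the
   additional premise on the product of the factors for the asymptotic part. *)
Theorem proposition5p8 (R : realType) (disp : measure_display)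
    (Omega : measurableType disp) (P : probability Omega R)
    (F : R -> set (set Omega)) (m d k : nat)
    (W : 'I_m -> R -> Omega -> R)
    (A : R -> 'M[R]_d) (B : 'I_m -> R -> 'M[R]_d) (t : nat -> R)
    (k_gt0 : (0 < k)%N) (k_le_d : (k <= d)%N)
    (usualF : usual_conditions P F)
    (brownianW : brownian_motion P F W)
    (lipA : lipschitz_coeff A) (lipB : forall i, lipschitz_coeff (B i))
    (t_start : t 0%N = 0) (t_incr : forall n, t n < t n.+1)
    (growth_lt1 : forall n,
       `|growth_factor (A (t n)) (fun i => B i (t n)) (t n.+1 - t n)| < 1) :
  mean_square_stable P (@dlr_scheme R disp Omega P F m d k W A B t) /\
  ((fun n => \prod_(j < n)
      `|growth_factor (A (t j)) (fun i => B i (t j)) (t j.+1 - t j)|)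
     @ \oo --> (0 : R) ->
   asymptotically_mean_square_stable P
     (@dlr_scheme R disp Omega P F m d k W A B t)).

Proof.
have stable : mean_square_stable P (@dlr_scheme R disp Omega P F m d k W A B t).
  (* [delta = eps] works: products of factors at most 1 give [e n <= e 0] for all [n], so the
     supremum stays strictly below [eps]. *)
  move=> eps eps0; exists eps => // U Y run.
  have [e [eE e_le]] := mean_square_dlr usualF brownianW t_start t_incr run.
  rewrite eE => e0; apply: le_lt_trans e0.
  apply: ge_ereal_sup => _ [n _ <-]; rewrite eE lee_fin.
  have /andP[_ /le_trans] := e_le n; apply.
  have /andP[e00 _] := e_le 0%N.
  rewrite ler_piMl//; apply: prodr_ile1 => j _.
  by rewrite normr_ge0 ltW.
split=> // prod0; split=> // U Y run.
have [e [eE e_le]] := mean_square_dlr usualF brownianW t_start t_incr run.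
under eq_cvg do rewrite eE.
apply: cvg_EFin; first by near=> n.
(* The energies lie between 0 and the vanishing products times the fixed number [e 0]. *)
apply: (@squeeze_cvgr _ _ _ _ (fun=> 0) (fun n => \prod_(j < n) `|growth_factor
    (A (t j)) (fun i => B i (t j)) (t j.+1 - t j)| * e 0%N)).
- by near=> n; exact: e_le.
- exact: cvg_cst.
- by rewrite -(mul0r (e 0%N)); apply: cvgMl.
Unshelve. all: by end_near. Qed.
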